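(* Let $(\mathcal{X}, p(y,z|x), \mathcal{Y}\times\mathcal{Z})$ be a two-receiver discrete memoryless broadcast channel. If a rate triple $(R_0,R_1,R_2)$ lies in its capacity region, then there exist discrete random variables $U,V,W,X,Y,Z$ with joint distribution of the form $$p(u,v,w,x,y,z)=p(u)\,p(v)\,p(w|u,v)\,p(x|u,v,w)\,p(y,z|x)$$ (where $p(y,z|x)$ is the channel transition function) such that \begin{align*} R_0 &\le \min\{I(W;Y),\, I(W;Z)\},\\ R_0+R_1 &\le I(U,W;Y),\\ R_0+R_2 &\le I(V,W;Z),\\ R_0+R_1+R_2 &\le I(U,W;Y)+I(V;Z|U,W),\\ R_0+R_1+R_2 &\le I(V,W;Z)+I(U;Y|V,W). \end{align*} That is, the set of all rate triples satisfying these inequalities for some such distribution contains the capacity region.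
   Context: A two-receiver discrete memoryless (DM) broadcast channel consists of a finite input alphabet $\mathcal{X}$, finite output alphabets $\mathcal{Y},\mathcal{Z}$, and a transition probability $p(y,z|x)$, used memorylessly over $n$ channel uses. A $((2^{nR_0},2^{nR_1},2^{nR_2}),n)$ code consists of three independent messages $(M_0,M_1,M_2)$ uniformly distributed over $[1,2^{nR_0}]\times[1,2^{nR_1}]\times[1,2^{nR_2}]$, an encoder assigning a codeword $x^n(m_0,m_1,m_2)$ to each message triple, a decoder mapping $y^n$ to an estimate $(\hat m_0,\hat m_1)$ and a decoder mapping $z^n$ to an estimate $(\hat{\hat m}_0,\hat m_2)$. The error probability is $P_e^{(n)}=P(\hat M_0\ne M_0 \text{ or } \hat{\hat M}_0\ne M_0 \text{ or } \hat M_1\ne M_1 \text{ or }\hat M_2\ne M_2)$. A triple $(R_0,R_1,R_2)$ is achievable if there is a sequence of such codes with $P_e^{(n)}\to 0$; the capacity region is the closure of the set of achievable triples. ($M_0$ is the common message, $M_1,M_2$ the private messages.) *)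

(* Defs.v *)
From HB Require Import structures.
From mathcomp Require Import all_boot all_order all_algebra.
From mathcomp Require Import all_classical all_reals all_analysis.
Set Implicit Arguments. Unset Strict Implicit. Unset Printing Implicit Defensive.
Import Order.TTheory GRing.Theory Num.Theory.
Import numFieldNormedType.Exports.
Local Open Scope classical_set_scope.
Local Open Scope ring_scope.

Section InfoTheory.
Variable R : realType.

(* logarithm in base 2; note ln 0 = 0 in mathcomp-analysis, so 0 log 0 = 0 *)
Definition log2 (x : R) : R := ln x / ln 2.

Definition law (Omega : finType) (P : Omega -> R) (T : finType) (f : Omega -> T)
  (t : T) : R := \sum_(o | f o == t) P o.

Definition entropy (Omega : finType) (P : Omega -> R) (T : finType)
  (f : Omega -> T) : R :=
  - \sum_(t : T) law P f t * log2 (law P f t).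

Definition mutinfo (Omega : finType) (P : Omega -> R) (T1 T2 : finType)
  (f : Omega -> T1) (g : Omega -> T2) : R :=
  entropy P f + entropy P g - entropy P (fun o => (f o, g o)).

Definition cmutinfo (Omega : finType) (P : Omega -> R) (T1 T2 T3 : finType)
  (f : Omega -> T1) (g : Omega -> T2) (h : Omega -> T3) : R :=
  entropy P (fun o => (f o, h o)) + entropy P (fun o => (g o, h o))
  - entropy P (fun o => (f o, g o, h o)) - entropy P h.

Definition is_bc_channel (X Y Z : finType) (ch : X -> Y -> Z -> R) : Prop :=
  (forall x y z, 0 <= ch x y z) /\
  (forall x, \sum_(y : Y) \sum_(z : Z) ch x y z = 1).

Record bc_code (X Y Z : finType) (n : nat) := BcCode {
  size0 : nat; size1 : nat; size2 : nat;
  encoder : 'I_size0 -> 'I_size1 -> 'I_size2 -> n.-tuple X;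
  decoder1 : n.-tuple Y -> 'I_size0 * 'I_size1;
  decoder2 : n.-tuple Z -> 'I_size0 * 'I_size2 }.

Definition channel_n (X Y Z : finType) (ch : X -> Y -> Z -> R) (n : nat)
  (x : n.-tuple X) (y : n.-tuple Y) (z : n.-tuple Z) : R :=
  \prod_(i < n) ch (tnth x i) (tnth y i) (tnth z i).

Definition error_prob (X Y Z : finType) (ch : X -> Y -> Z -> R) (n : nat)
  (c : bc_code X Y Z n) : R :=
  ((size0 c * size1 c * size2 c)%:R)^-1 *
  \sum_(m0 : 'I_(size0 c)) \sum_(m1 : 'I_(size1 c)) \sum_(m2 : 'I_(size2 c))
   \sum_(y : n.-tuple Y) \sum_(z : n.-tuple Z)
     channel_n ch (@encoder _ _ _ _ c m0 m1 m2) y z *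
     (if [|| (@decoder1 _ _ _ _ c y).1 != m0, (@decoder2 _ _ _ _ c z).1 != m0,
             (@decoder1 _ _ _ _ c y).2 != m1 | (@decoder2 _ _ _ _ c z).2 != m2]
      then 1 else 0).

Definition achievable (X Y Z : finType) (ch : X -> Y -> Z -> R)
  (R0 R1 R2 : R) : Prop :=
  0 <= R0 /\ 0 <= R1 /\ 0 <= R2 /\
  exists c : forall n : nat, bc_code X Y Z n,
    (forall n, 2 `^ (n%:R * R0) <= (size0 (c n))%:R /\
               2 `^ (n%:R * R1) <= (size1 (c n))%:R /\
               2 `^ (n%:R * R2) <= (size2 (c n))%:R) /\
    (fun n => error_prob ch (c n)) @ \oo --> (0 : R).

Definition in_capacity_region (X Y Z : finType) (ch : X -> Y -> Z -> R)
  (R0 R1 R2 : R) : Prop :=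
  forall e : R, 0 < e -> exists r0 r1 r2, achievable ch r0 r1 r2 /\
    `|r0 - R0| < e /\ `|r1 - R1| < e /\ `|r2 - R2| < e.

Definition is_pmf (T : finType) (p : T -> R) : Prop :=
  (forall t, 0 <= p t) /\ \sum_(t : T) p t = 1.

End InfoTheory.

(* Main.v *)
(** The n-letter converse uses W_i = (M_0, Y^{i-1}, Z_{i+1}^n), U = M_1, V = M_2:
    Fano's inequality, the chain rule and Csiszar's sum identity bound the rates of a code,
    up to a vanishing slack, by the five right-hand sides averaged over i.  When X is a
    function of (U,V,W), as may be arranged, those bounds depend on the joint law only
    through the laws of (W,U,X) and (W,V,X), and they are averages of the homogeneous
    function mu |-> |mu| log |mu| - sum mu log mu of unnormalised laws.  Hence
    Caratheodory's theorem bounds the alphabets of U, V and W, and compactness removes the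
    slack.  Finally U and V become independent by one-time pads: U and V are replaced by
    uniform keys, and W by itself together with U, V and X encrypted with these keys.  This
    preserves the bounds and makes X a function of the three new variables. *)
Require Import Defs.
From HB Require Import structures.
From mathcomp Require Import all_boot all_order all_algebra.
From mathcomp Require Import all_classical all_reals all_analysis.
From mathcomp Require Import ring lra.
Set Implicit Arguments. Unset Strict Implicit. Unset Printing Implicit Defensive.
Import Order.TTheory GRing.Theory Num.Theory.
Import numFieldNormedType.Exports.
Local Open Scope ring_scope.

(** * Entropy of unnormalised laws and Gibbs' inequality *)

Section HomogeneousEntropy.
Variable R : realType.
Implicit Types x y : R.

(** The conclusion asks for finite alphabets, yet the slack of a code vanishes only as the block
    length grows, and the messages and contexts grow with it. Passing to the limit therefore
    requires alphabets of a fixed size, and the reduction to that size treats U and V separately for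
    each value of W, which destroys their independence. For this reason independence is not carried
    along; it is restored at the very end.

    Two relaxations make this possible. In the sum bounds the residual entropies H(Z|U,V,W) and
    H(Y|U,V,W) are replaced by H(Z|X) and H(Y|X), which are linear in the input law. This can only
    enlarge the right-hand sides, and it costs nothing once X is a function of the padded variables.
    Moreover the only trace of the dependence between U and V that is kept is the common
    (W,X)-marginal of the two laws; any such pair of laws comes from some joint law.

    Working with unnormalised slices of a law avoids conditional probabilities, and with them all
    divisions by the probability of a conditioning event. *)

Definition xlog x : R := x * log2 x.

(** The total mass of [mu] times the entropy of the normalised law. A conditional entropy is then
    the plain sum of [hent] over the slices of a joint law, and slices of mass 0 contribute 0. *)
Definition hent (T : finType) (mu : T -> R) : R :=
  xlog (\sum_t mu t) - \sum_t xlog (mu t).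

Lemma ln2_gt0 : 0 < ln (2 : R).
Proof. by apply: ln_gt0; rewrite ltr1n. Qed.

Lemma xlog0 : xlog 0 = 0.
Proof. by rewrite /xlog mul0r. Qed.

Lemma xlog1 : xlog 1 = 0.
Proof. by rewrite /xlog /log2 ln1 mul0r mulr0. Qed.

Lemma log2M x y : 0 < x -> 0 < y -> log2 (x * y) = log2 x + log2 y.
Proof. by move=> x0 y0; rewrite /log2 lnM ?posrE// mulrDl. Qed.

Lemma log2V x : 0 < x -> log2 x^-1 = - log2 x.
Proof. by move=> x0; rewrite /log2 lnV ?posrE// mulNr. Qed.

Lemma log2_2 : log2 (2 : R) = 1.
Proof. by rewrite /log2 divff// gt_eqF// ln2_gt0. Qed.

Lemma log2_le_sub x : 0 < x -> log2 x <= (x - 1) / ln 2.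
Proof.
move=> x0; rewrite /log2 ler_pM2r ?invr_gt0 ?ln2_gt0//.
rewrite -[X in ln X](subrKC 1); apply: le_ln1Dx.
by rewrite ltrBDr addrC subrr || lra.
Qed.

Lemma xlogM x y : 0 <= x -> 0 <= y -> xlog (x * y) = x * xlog y + y * xlog x.
Proof.
rewrite !le_eqVlt => /predU1P[<-|x0] /predU1P[<-|y0];
  rewrite ?(mul0r, mulr0, xlog0, addr0)//.
by rewrite /xlog log2M//; ring.
Qed.

(** The tangent bound on the logarithm at [y / x], multiplied by [x]. The last hypothesis is
    absolute continuity: since [ln 0 = 0], the inequality can fail for [y = 0 < x]. *)
Lemma gibbs_pointwise x y : 0 <= x -> 0 <= y -> (0 < x -> 0 < y) ->
  x * (log2 y - log2 x) <= (y - x) / ln 2.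
Proof.
move=> x0 y0; move: x0; rewrite le_eqVlt => /predU1P[<- _|x0 /(_ x0) {}y0].
  by rewrite mul0r subr0 divr_ge0// ltW// ln2_gt0.
rewrite -log2V// -log2M ?invr_gt0//.
rewrite -(ler_pM2l (x := x^-1)) ?invr_gt0// mulrA mulVf ?gt_eqF// mul1r.
apply: le_trans (log2_le_sub _) _; first by rewrite mulr_gt0 ?invr_gt0.
by rewrite mulrA mulrBr mulVf ?gt_eqF// [y * _]mulrC.
Qed.

Lemma hentZ (T : finType) (mu : T -> R) x : 0 <= x -> (forall t, 0 <= mu t) ->
  hent (fun t => x * mu t) = x * hent mu.
Proof.
move=> x0 mu0; rewrite /hent -mulr_sumr xlogM ?sumr_ge0//.
rewrite [X in _ - X](eq_bigr (fun t => x * xlog (mu t) + mu t * xlog x)); last first.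
  by move=> t _; rewrite xlogM.
by rewrite big_split/= -mulr_sumr -mulr_suml; ring.
Qed.

Lemma eq_hent (T : finType) (mu nu : T -> R) : mu =1 nu -> hent mu = hent nu.
Proof.
by move=> /funext ->.
Qed.

(* Gibbs' inequality for the joint mass N against the product of its marginals. *)
Lemma hent_superadditive (B T : finType) (N : B -> T -> R) :
  (forall b t, 0 <= N b t) ->
  \sum_b hent (N b) <= hent (fun t => \sum_b N b t).
Proof.
move=> N0; pose r b := \sum_t N b t; pose c t := \sum_b N b t; pose S := \sum_b r b.
have Sc : S = \sum_t c t by rewrite /S exchange_big.
have r0 b : 0 <= r b by exact: sumr_ge0.
have c0 t : 0 <= c t by exact: sumr_ge0.
have S0 : 0 <= S by exact: sumr_ge0.
have rN b t : N b t <= r b by rewrite /r (bigD1 t)//= lerDl sumr_ge0.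
have cN b t : N b t <= c t by rewrite /c (bigD1 b)//= lerDl sumr_ge0.
have Sr b : r b <= S by rewrite /S (bigD1 b)//= lerDl sumr_ge0.
have pt b t : N b t * (log2 (c t) + log2 (r b) - log2 S - log2 (N b t))
    <= (c t * r b / S - N b t) / ln 2.
  have [N0'|] := ltrP 0 (N b t); last first.
    move=> Nle; have -> : N b t = 0 by apply/eqP; rewrite eq_le Nle N0.
    by rewrite mul0r subr0 !divr_ge0 ?mulr_ge0// ltW// ln2_gt0.
  have rp := lt_le_trans N0' (rN b t); have cp := lt_le_trans N0' (cN b t).
  have Sp := lt_le_trans rp (Sr b).
  rewrite -log2M// -[- log2 S]log2V// -log2M ?mulr_gt0 ?invr_gt0//.
  by apply: gibbs_pointwise => //; rewrite ?divr_gt0 ?mulr_gt0// ?divr_ge0 ?mulr_ge0.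
have tot : \sum_b \sum_t (c t * r b / S - N b t) / ln 2 = 0.
  under eq_bigr do rewrite -mulr_suml big_split/= sumrN -!mulr_suml -Sc.
  rewrite -mulr_suml big_split/= sumrN -!mulr_suml -mulr_sumr -/S.
  have [->|Sn0] := eqVneq S 0; first by rewrite !mul0r subrr mul0r.
  by rewrite mulfK// subrr mul0r.
have le0 : \sum_b \sum_t N b t * (log2 (c t) + log2 (r b) - log2 S - log2 (N b t)) <= 0.
  by rewrite -[leRHS]tot; apply: ler_sum => b _; apply: ler_sum => t _; exact: pt.
rewrite -subr_ge0 -oppr_le0; apply: le_trans le0.
rewrite le_eqVlt; apply/orP; left; apply/eqP.
rewrite /hent -/(c _) big_split/= sumrN -[\sum_t \sum_b N b t]Sc.
have -> : \sum_t xlog (\sum_b N b t) = \sum_b \sum_t N b t * log2 (c t).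
  by rewrite exchange_big; apply: eq_bigr => t _; rewrite -mulr_suml.
have -> : \sum_b xlog (\sum_t N b t) = \sum_b \sum_t N b t * log2 (r b).
  by apply: eq_bigr => b _; rewrite -mulr_suml.
have -> : xlog S = \sum_b \sum_t N b t * log2 S.
  by under eq_bigr do rewrite -mulr_suml; rewrite -mulr_suml.
rewrite -!sumrB -sumrN; apply: eq_bigr => b _; rewrite -!sumrB -sumrN.
by apply: eq_bigr => t _; rewrite /xlog; ring.
Qed.

(* Gibbs' inequality against the mass 1/2 at t0 and 1/(2#|T|) elsewhere. *)
Lemma hent_fano (T : finType) (mu : T -> R) (t0 : T) : (forall t, 0 <= mu t) ->
  hent mu <= \sum_t mu t + (\sum_(t | t != t0) mu t) * log2 #|T|%:R.
Proof.
move=> mu0; set s := \sum_t mu t.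
have T0 : 0 < #|T|%:R :> R by rewrite ltr0n; apply/card_gt0P; exists t0.
have s0 : 0 <= s by exact: sumr_ge0.
pose q t : R := if t == t0 then 2^-1 else (2 * #|T|%:R)^-1.
have q0 t : 0 < q t by rewrite /q; case: ifP => _; rewrite invr_gt0 ?mulr_gt0.
have lq t : log2 (q t) = - 1 - (if t == t0 then 0 else log2 #|T|%:R).
  by rewrite /q; case: ifP => _; rewrite log2V ?mulr_gt0 ?log2M// log2_2 ?opprD ?subr0.
have sq : \sum_t q t <= 1.
  rewrite (bigD1 t0)//= {1}/q eqxx.
  rewrite (eq_bigr (fun=> (2 * #|T|%:R)^-1)); last by move=> t /negbTE; rewrite /q => ->.
  rewrite sumr_const [leRHS](splitr 1) div1r lerD2l -[leLHS]mulr_natl.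
  rewrite invfM mulrCA ger_pMr ?invr_gt0// ler_pdivrMr// mul1r ler_nat.
  exact: max_card.
have pt t : mu t * (log2 s + log2 (q t) - log2 (mu t)) <= (s * q t - mu t) / ln 2.
  have [m0|] := ltrP 0 (mu t); last first.
    move=> m0; have -> : mu t = 0 by apply/eqP; rewrite eq_le m0 mu0.
    by rewrite mul0r subr0 divr_ge0 ?mulr_ge0// ltW// ?ln2_gt0.
  have sp : 0 < s by apply: (lt_le_trans m0); rewrite /s (bigD1 t)//= lerDl sumr_ge0.
  by rewrite -log2M//; apply: gibbs_pointwise => // [|_]; [apply: ltW|]; rewrite mulr_gt0.
have le0 : \sum_t mu t * (log2 s + log2 (q t) - log2 (mu t)) <= 0.
  apply: (le_trans (ler_sum _ (fun t (_ : true) => pt t))).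
  rewrite -mulr_suml sumrB -/s -mulr_sumr pmulr_lle0 ?invr_gt0 ?ln2_gt0//.
  by rewrite subr_le0 ler_piMr.
rewrite -subr_le0; apply: le_trans le0; rewrite le_eqVlt; apply/orP; left; apply/eqP.
have -> : \sum_t mu t * (log2 s + log2 (q t) - log2 (mu t)) =
    \sum_t mu t * log2 s - s - \sum_t (if t != t0 then mu t * log2 #|T|%:R else 0)
    - \sum_t xlog (mu t).
  rewrite /s -!sumrB; apply: eq_bigr => t _; rewrite lq /xlog.
  by case: eqP => _ /=; ring.
by rewrite -big_mkcond/= -!mulr_suml /hent -/s /xlog; ring.
Qed.

End HomogeneousEntropy.

(** * Conditional entropy and Fano's inequality *)

Section RandomVariables.
Variables (R : realType) (Omega : finType) (P : Omega -> R).
Hypothesis P0 : forall o, 0 <= P o.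
Implicit Types A B C : finType.

Lemma law_ge0 A (f : Omega -> A) a : 0 <= law P f a.
Proof. exact: sumr_ge0. Qed.

Lemma sum_law A (f : Omega -> A) (F : A -> R) :
  \sum_a law P f a * F a = \sum_o P o * F (f o).
Proof.
rewrite (partition_big f xpredT)//=; apply: eq_bigr => a _.
by rewrite mulr_suml; apply: eq_bigr => o /eqP ->.
Qed.

Lemma law_total A (f : Omega -> A) : \sum_a law P f a = \sum_o P o.
Proof.
by have := sum_law f (fun=> 1); under eq_bigr do rewrite mulr1; under [RHS]eq_bigr do rewrite mulr1.
Qed.

Lemma law_pairr A B (f : Omega -> A) (g : Omega -> B) b :
  \sum_a law P (fun o => (f o, g o)) (a, b) = law P g b.
Proof.
rewrite /law [RHS](partition_big f xpredT)//=; apply: eq_bigr => a _.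
by apply: eq_bigl => o; rewrite xpair_eqE andbC.
Qed.

Lemma entropyE A (f : Omega -> A) :
  entropy P f = - \sum_o P o * log2 (law P f (f o)).
Proof. by rewrite /entropy sum_law. Qed.

(** Entropy sees only the partition of [Omega] into fibres. Regrouping or recoding variables thus
    amounts to comparing kernels, and no bijection between codomains is built. *)
Lemma entropy_ker A B (f : Omega -> A) (g : Omega -> B) :
  (forall o o', (f o == f o') = (g o == g o')) -> entropy P f = entropy P g.
Proof.
move=> fg; rewrite !entropyE; congr (- _); apply: eq_bigr => o _.
by congr (_ * log2 _); apply: eq_bigl => o'; rewrite fg.
Qed.

Lemma entropy_uniform A (f : Omega -> A) : (0 < #|A|)%N ->
  (forall a, law P f a = (#|A|%:R)^-1) -> entropy P f = log2 #|A|%:R.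
Proof.
move=> A0 fu; rewrite /entropy; under eq_bigr do rewrite fu.
rewrite sumr_const log2V ?ltr0n// mulrN mulNrn opprK -[LHS]mulr_natl mulrA divff ?mul1r//.
by rewrite pnatr_eq0 -lt0n.
Qed.

Definition cent A B (f : Omega -> A) (g : Omega -> B) : R :=
  entropy P (fun o => (f o, g o)) - entropy P g.

Lemma centE A B (f : Omega -> A) (g : Omega -> B) :
  cent f g = \sum_b hent (fun a => law P (fun o => (f o, g o)) (a, b)).
Proof.
rewrite /cent /entropy opprK addrC /hent sumrB; congr (_ - _).
  by apply: eq_bigr => b _; rewrite law_pairr.
by rewrite exchange_big/= pair_bigA/=; apply: eq_bigr => -[a b] _.
Qed.

Lemma cent_ker A B C (f : Omega -> A) (g : Omega -> B) (h : Omega -> C) :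
  (forall o o', (g o == g o') = (h o == h o')) -> cent f g = cent f h.
Proof.
move=> gh; rewrite /cent (entropy_ker gh); congr (_ - _).
by apply: entropy_ker => o o'; rewrite !xpair_eqE gh.
Qed.

(** Conditioning reduces entropy: for each value of [h], superadditivity of [hent] merges the slices
    belonging to the different values of [g]. *)
Lemma cent_coarsen A B C (f : Omega -> A) (g : Omega -> B) (h : Omega -> C) :
  (forall o o', g o = g o' -> h o = h o') -> cent f g <= cent f h.
Proof.
move=> gh; rewrite (@cent_ker _ _ _ f g (fun o => (g o, h o))); last first.
  move=> o o'; rewrite xpair_eqE; case: (eqVneq (g o)) => //= /gh ->.
  by rewrite eqxx.
rewrite !centE
  -(pair_bigA _ (fun b c => hent (fun a => law P (fun o => (f o, (g o, h o))) (a, (b, c)))))/=.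
rewrite exchange_big/=; apply: ler_sum => c _.
rewrite (le_trans (hent_superadditive _))//; first by move=> *; exact: law_ge0.
rewrite le_eqVlt; apply/orP; left; apply/eqP; congr hent; apply/funext => a.
rewrite -(law_pairr g); apply: eq_bigr => b _; apply: eq_bigl => o.
by rewrite !xpair_eqE; do 2 case: eqP.
Qed.

Hypothesis P1 : \sum_o P o = 1.

Lemma entropy_unit (f : Omega -> unit) : entropy P f = 0.
Proof.
rewrite /entropy (bigD1 tt)//= big1 ?addr0; last by case.
suff -> : law P f tt = 1 by rewrite -[_ * _]/(xlog 1) xlog1 oppr0.
by rewrite -P1; apply: eq_bigl => o; case: (f o).
Qed.

Lemma cent_le_entropy A B (f : Omega -> A) (g : Omega -> B) :
  cent f g <= entropy P f.
Proof.
apply: (@le_trans _ _ (cent f (fun=> tt))); first exact: cent_coarsen.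
rewrite /cent entropy_unit subr0 le_eqVlt; apply/orP; left; apply/eqP.
by apply: entropy_ker => o o'; rewrite xpair_eqE andbT.
Qed.

(** [hent_fano] is applied to the slice of each [b] with distinguished point [dec b]. The masses of
    the slices add up to 1, those of the wrong guesses to the error probability. *)
Lemma fano A B (f : Omega -> A) (g : Omega -> B) (dec : B -> A) :
  cent f g <= 1 + (\sum_(o | dec (g o) != f o) P o) * log2 #|A|%:R.
Proof.
rewrite centE.
have le b := @hent_fano _ _ _ (dec b) (fun a => law_ge0 (fun o => (f o, g o)) (a, b)).
apply: (le_trans (ler_sum _ (fun b _ => le b))).
rewrite big_split/= -mulr_suml; under eq_bigr do rewrite law_pairr.
rewrite law_total P1 lerD2l le_eqVlt; apply/orP; left; apply/eqP; congr (_ * _).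
have := sum_law (fun o => (f o, g o)) (fun ab => (dec ab.2 != ab.1)%:R).
rewrite -(pair_bigA _ (fun a b => law P (fun o => (f o, g o)) (a, b) * (dec b != a)%:R))/=.
rewrite exchange_big/= => e.
under eq_bigr do rewrite big_mkcond/=.
rewrite [RHS]big_mkcond/=; transitivity (\sum_o P o * (dec (g o) != f o)%:R).
  rewrite -e; apply: eq_bigr => b _; apply: eq_bigr => a _.
  by rewrite eq_sym; case: ifP => _; rewrite ?mulr1 ?mulr0.
by apply: eq_bigr => o _; case: ifP => _; rewrite ?mulr1 ?mulr0.
Qed.

End RandomVariables.

(** * Chain rules for blocks and Csiszar's sum identity *)

Section Blocks.
Variables (R : realType) (Omega : finType) (P : Omega -> R).
Hypotheses (P0 : forall o, 0 <= P o) (P1 : \sum_o P o = 1).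
Variables (TY TZ : finType) (n : nat) (Y : Omega -> {ffun 'I_n -> TY})
  (Z : Omega -> {ffun 'I_n -> TZ}).

(** Prefixes are filled up with [None] so that all lengths share one codomain. *)
Definition past (k : nat) (o : Omega) : {ffun 'I_n -> option TY} :=
  [ffun i : 'I_n => if (i < k)%N then Some (Y o i) else None].

(* Interpolates between Z^n at k = 0 and Y^n at k = n, as in Csiszar's sum identity. *)
Definition mixed (k : nat) (o : Omega) : {ffun 'I_n -> TY + TZ} :=
  [ffun i : 'I_n => if (i < k)%N then inl (Y o i) else inr (Z o i)].

(** The past of [Y] and the future of [Z] around position [k]: the common part of [mixed k], which
    adds the letter of [Z], and [mixed k.+1], which adds the letter of [Y]. *)
Definition context (k : 'I_n) (o : Omega) : {ffun 'I_n -> option (TY + TZ)} :=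
  [ffun i : 'I_n => if i == k then None else Some (mixed k o i)].

Lemma past_eqP k o o' :
  reflect (forall i : 'I_n, (i < k)%N -> Y o i = Y o' i) (past k o == past k o').
Proof.
apply: (iffP eqP) => [/ffunP e i ik|e].
  by have := e i; rewrite !ffunE ik => -[].
by apply/ffunP => i; rewrite !ffunE; case: ifP => // /e ->.
Qed.

Lemma mixed_eqP k o o' :
  reflect (forall i : 'I_n, if (i < k)%N then Y o i = Y o' i else Z o i = Z o' i)
    (mixed k o == mixed k o').
Proof.
apply: (iffP eqP) => [/ffunP e i|e].
  by have := e i; rewrite !ffunE; case: ifP => _ [].
by apply/ffunP => i; rewrite !ffunE; have := e i; case: ifP => _ ->.
Qed.

Lemma context_eqP (k : 'I_n) o o' :
  reflect (forall i : 'I_n, i != k ->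
     if (i < k)%N then Y o i = Y o' i else Z o i = Z o' i)
    (context k o == context k o').
Proof.
apply: (iffP eqP) => [/ffunP e i /negbTE ik|e].
  by have := e i; rewrite !ffunE ik; case: ifP => _ [].
apply/ffunP => i; rewrite !ffunE; case: eqVneq => // /e.
by case: ifP => _ ->.
Qed.

Lemma mixed_n_eq o o' : (mixed n o == mixed n o') = (Y o == Y o').
Proof.
apply/mixed_eqP/eqP => [e|-> i]; last by rewrite ltn_ord.
by apply/ffunP => i; have := e i; rewrite ltn_ord.
Qed.

Lemma mixed_0_eq o o' : (mixed 0 o == mixed 0 o') = (Z o == Z o').
Proof.
apply/mixed_eqP/eqP => [e|-> //].
by apply/ffunP => i; exact: (e i).
Qed.

Lemma mixed_k_eq (k : 'I_n) o o' :
  (mixed k o == mixed k o') = (Z o k == Z o' k) && (context k o == context k o').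
Proof.
apply/mixed_eqP/andP => [e|[/eqP ez /context_eqP e] i].
  split; first by apply/eqP; have := e k; rewrite ltnn.
  by apply/context_eqP => i _; exact: e.
by case: (eqVneq i k) => [->|/e//]; rewrite ltnn.
Qed.

Lemma mixed_kS_eq (k : 'I_n) o o' :
  (mixed k.+1 o == mixed k.+1 o') = (Y o k == Y o' k) && (context k o == context k o').
Proof.
have lt (i : 'I_n) : i != k -> (i < k.+1)%N = (i < k)%N.
  by move=> ik; rewrite ltnS leq_eqVlt (inj_eq val_inj) (negbTE ik).
apply/mixed_eqP/andP => [e|[/eqP ey /context_eqP e] i].
  split; first by apply/eqP; have := e k; rewrite ltnSn.
  by apply/context_eqP => i ik; have := e i; rewrite lt.
by case: (eqVneq i k) => [->|ik]; [rewrite ltnSn|rewrite lt//; exact: e].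
Qed.

Lemma past_kS_eq (k : 'I_n) o o' :
  (past k.+1 o == past k.+1 o') = (Y o k == Y o' k) && (past k o == past k o').
Proof.
apply/past_eqP/andP => [e|[/eqP ey /past_eqP e] i].
  split; first by apply/eqP/e; rewrite ltnSn.
  by apply/past_eqP => i ik; apply: e; rewrite ltnS ltnW.
by rewrite ltnS leq_eqVlt => /orP[/eqP/val_inj ->|/e].
Qed.

Lemma past_n_eq o o' : (past n o == past n o') = (Y o == Y o').
Proof.
apply/past_eqP/eqP => [e|-> //].
by apply/ffunP => i; exact: e.
Qed.

Lemma past_0_eq o o' : past 0 o == past 0 o'.
Proof. exact/past_eqP. Qed.

Variables (TK : finType) (K : Omega -> TK).

Lemma entropy_block_le : entropy P Y <= \sum_(i < n) entropy P (fun o => Y o i).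
Proof.
pose F k := entropy P (past k).
have <- : F n = entropy P Y by apply: entropy_ker => o o'; rewrite past_n_eq.
have F0 : F 0%N = 0.
  rewrite -(entropy_unit P1 (fun=> tt)); apply: entropy_ker => o o'.
  by rewrite past_0_eq eqxx.
rewrite -[leLHS]subr0 -[X in _ - X]F0 -telescope_sumr// big_mkord.
apply: ler_sum => k _; apply: le_trans (cent_le_entropy P0 P1 _ (past k)).
rewrite lerD2r le_eqVlt; apply/orP; left; apply/eqP; apply: entropy_ker => o o'.
by rewrite xpair_eqE past_kS_eq.
Qed.

(** The chain rule along the past of [Y]. The context also contains the future of [Z], and this
    extra conditioning lowers each term. *)
Lemma cent_block_ge :
  \sum_(i < n) cent P (fun o => Y o i) (fun o => (context i o, K o)) <= cent P Y K.
Proof.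
pose F k := entropy P (fun o => (past k o, K o)).
have -> : cent P Y K = F n - F 0%N.
  congr (_ - _); apply: entropy_ker => o o'; rewrite !xpair_eqE ?past_n_eq//.
  by rewrite past_0_eq.
rewrite -telescope_sumr// big_mkord; apply: ler_sum => k _.
apply: le_trans (_ : cent P (fun o => Y o k) (fun o => (past k o, K o)) <= _).
  apply: cent_coarsen => // o o' [/eqP/context_eqP e ->]; congr pair.
  apply/eqP/past_eqP => i ik; have := e i; rewrite ik; apply.
  by apply: contraTneq ik => ->; rewrite ltnn.
rewrite lerD2r le_eqVlt; apply/orP; left; apply/eqP; apply: entropy_ker => o o'.
by rewrite !xpair_eqE past_kS_eq andbA.
Qed.

(** The entropy of [mixed k] with [K] telescopes: one step exchanges a letter of [Z] for one of [Y]
    around the same context, so the entropy of the context with [K] cancels. *)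
Lemma csiszar_sum :
  \sum_(i < n) (cent P (fun o => Y o i) (fun o => (context i o, K o)) -
                cent P (fun o => Z o i) (fun o => (context i o, K o))) =
  cent P Y K - cent P Z K.
Proof.
pose F k := entropy P (fun o => (mixed k o, K o)).
transitivity (F n - F 0%N).
  rewrite -telescope_sumr// big_mkord; apply: eq_bigr => k _.
  rewrite /cent opprB addrA subrK; congr (_ - _); apply: entropy_ker => o o'.
    by rewrite !xpair_eqE mixed_kS_eq andbA.
  by rewrite !xpair_eqE mixed_k_eq andbA.
rewrite /cent opprB addrA subrK; congr (_ - _); apply: entropy_ker => o o'.
  by rewrite !xpair_eqE mixed_n_eq.
by rewrite !xpair_eqE mixed_0_eq.
Qed.

(** The mirror image of [cent_block_ge], read off from Csiszar's identity instead of a second chain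
    rule running backwards. *)
Lemma cent_block_ge_future :
  \sum_(i < n) cent P (fun o => Z o i) (fun o => (context i o, K o)) <= cent P Z K.
Proof.
have le (a b c d : R) : a - b = c - d -> a <= c -> b <= d by lra.
by have := csiszar_sum; rewrite sumrB => /le; apply; exact: cent_block_ge.
Qed.

End Blocks.

(** * Caratheodory's theorem for convex cones *)

Section ConicCaratheodory.
Variables (R : realFieldType) (K : finType).

(** A nonzero vector of the left kernel, negated if necessary: the ratio test of [drop_generator]
    needs a positive coefficient. *)
Lemma linear_dependence n (v : 'I_n -> K -> R) : (#|K| < n)%N ->
  exists r : 'I_n -> R, (exists i, 0 < r i) /\ forall k, \sum_i r i * v i k = 0.
Proof.
move=> Kn; pose A : 'M[R]_(n, #|K|) := \matrix_(i, j) v i (enum_val j).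
have /rowV0Pn[r /sub_kermxP rA r0] : kermx A != 0.
  rewrite kermx_eq0 /row_free neq_ltn.
  by rewrite (leq_ltn_trans (rank_leq_col _)).
have rv k : \sum_i r 0 i * v i k = 0.
  have /matrixP/(_ 0 (enum_rank k)) := rA; rewrite !mxE => rk; rewrite -[RHS]rk.
  by apply: eq_bigr => i _; rewrite !mxE enum_rankK.
have [i ri] : exists i, r 0 i != 0.
  apply/existsP; apply: contraNT r0 => /existsPn e; apply/eqP/rowP => i.
  by rewrite mxE; apply/eqP; have := e i; rewrite negbK.
have [rp|rn] := ltrP 0 (r 0 i); first by exists (r 0); split=> //; exists i.
exists (fun j => - r 0 j); split; first by exists i; rewrite oppr_gt0 lt_neqAle ri.
by move=> k; under eq_bigr do rewrite mulNr; rewrite sumrN rv oppr0.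
Qed.

(** The largest multiple of the dependency that keeps the weights nonnegative is subtracted. It is
    the least ratio [w i / r i] over positive [r i], and the weight at its minimiser becomes 0. *)
Lemma drop_generator n (v : 'I_n -> K -> R) (w : 'I_n -> R) : (#|K| < n)%N ->
  (forall i, 0 <= w i) ->
  exists (m : 'I_n -> R) (j : 'I_n), [/\ m j = 0, forall i, 0 <= m i &
    forall k, \sum_i m i * v i k = \sum_i w i * v i k].
Proof.
move=> Kn w0; have [r [[i0 ri0] rv]] := linear_dependence v Kn.
have [j rj jmin] := @arg_minP _ _ 'I_n i0 (fun i => 0 < r i) (fun i => w i / r i) ri0.
exists (fun i => w i - w j / r j * r i), j; split.
- by rewrite divfK ?subrr// gt_eqF.
- move=> i; rewrite subr_ge0; have [rp|rn] := ltrP 0 (r i).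
    by rewrite -ler_pdivlMr// jmin.
  by apply: le_trans (w0 i); rewrite mulr_ge0_le0// divr_ge0// ltW.
- move=> k; transitivity (\sum_i (w i * v i k - w j / r j * (r i * v i k))).
    by apply: eq_bigr => i _; rewrite mulrBl mulrA.
  by rewrite sumrB -mulr_sumr rv mulr0 subr0.
Qed.

(** Generators are dropped until at most [d] remain. [None] marks a spare slot carrying the zero
    vector, which also covers an empty family. *)
Lemma caratheodory_ord d n (v : 'I_n -> K -> R) (w : 'I_n -> R) :
  (#|K| <= d)%N -> (forall i, 0 <= w i) ->
  exists (e : 'I_d -> option 'I_n) (m : 'I_d -> R), (forall j, 0 <= m j) /\
    forall k, \sum_j m j * oapp (v^~ k) 0 (e j) = \sum_i w i * v i k.
Proof.
move=> Kd; elim: n v w => [|n IHn] v w w0.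
  exists (fun=> None), (fun=> 0); split=> // k.
  by rewrite [RHS]big_ord0 big1// => j _; rewrite mul0r.
have [dn|nd] := ltnP d n.+1; last first.
  exists (fun j => insub (val j)), (fun j => oapp w 0 (insub (val j))); split.
    by move=> j; case: (insub _) => [i|] /=; [exact: w0|exact: lexx].
  move=> k; pose F (i : nat) := oapp w 0 (insub i) * oapp (v^~ k) 0 (insub i).
  rewrite -(big_mkord xpredT F) (@big_cat_nat _ _ _ n.+1)//=.
  rewrite [X in _ + X]big_nat_cond [X in _ + X]big1 ?addr0.
    by rewrite big_mkord; apply: eq_bigr => i _; rewrite /F valK.
  move=> i; rewrite andbT => /andP[ni _].
  by rewrite /F insubN ?mul0r// -leqNgt.
have [m [j [mj m0 mv]]] := drop_generator v (leq_ltn_trans Kd dn) w0.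
have [e [mu [mu0 muv]]] := IHn (fun i => v (lift j i)) (fun i => m (lift j i)) (fun i => m0 _).
exists (fun i => omap (lift j) (e i)), mu; split=> // k.
rewrite -mv (bigD1_ord j)//= mj mul0r add0r -muv.
by apply: eq_bigr => i _; case: (e i).
Qed.

(** The weights are not normalised, hence [#|K|] generators suffice instead of [#|K| + 1]. In the
    applications the total mass survives because it is a sum of preserved coordinates. *)
Lemma caratheodory (I : finType) (i0 : I) d (v : I -> K -> R) : (#|K| <= d)%N ->
  exists (e : 'I_d -> I) (m : 'I_d -> R), (forall j, 0 <= m j) /\
    forall k, \sum_j m j * v (e j) k = \sum_i v i k.
Proof.
move=> Kd.
have [e [m [m0 mv]]] := @caratheodory_ord d #|I| (fun i => v (enum_val i)) (fun=> 1) Kd (fun=> ler01).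
exists (fun j => oapp enum_val i0 (e j)), (fun j => if e j is Some _ then m j else 0).
split=> [j|k]; first by case: (e j).
transitivity (\sum_(i < #|I|) 1 * v (enum_val i) k); last first.
  by under eq_bigr do rewrite mul1r; rewrite [RHS](reindex _ (onW_bij _ (enum_val_bij I))).

by rewrite -mv; apply: eq_bigr => j _; case: (e j) => //=; rewrite mul0r mulr0.
Qed.

End ConicCaratheodory.

(** Alphabets are not assumed nonempty; their inhabitants are extracted from a total mass of 1. *)
Lemma sum_neq0_inhabited (V : nmodType) (T : finType) (F : T -> V) :
  \sum_t F t != 0 -> exists t : T, F t != 0.
Proof.
move=> F0; apply/existsP; apply: contraNT F0 => /existsPn e.
by rewrite big1// => t _; apply/eqP; have := e t; rewrite negbK.
Qed.

(** * The bound as a function of two laws, and the reduction of its alphabets *)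

Section AuxiliaryData.
Variables (R : realType) (X Y Z : finType) (kY : X -> Y -> R) (kZ : X -> Z -> R).
Hypotheses (kY0 : forall x y, 0 <= kY x y) (kZ0 : forall x z, 0 <= kZ x z).

Definition output (T : finType) (k : X -> T -> R) (mu : X -> R) (t : T) : R :=
  \sum_x mu x * k x t.

Definition hout (T : finType) (k : X -> T -> R) (mu : X -> R) : R :=
  hent (output k mu).

(** The entropy of the output given the input, weighted by mass. Being linear in [mu], it depends
    only on the overall input law, however that law is sliced. *)
Definition noise (T : finType) (k : X -> T -> R) (mu : X -> R) : R :=
  \sum_x mu x * hent (k x).

Lemma output_ge0 (T : finType) (k : X -> T -> R) (mu : X -> R) t :
  (forall x t, 0 <= k x t) -> (forall x, 0 <= mu x) -> 0 <= output k mu t.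
Proof. by move=> k0 mu0; apply: sumr_ge0 => x _; exact: mulr_ge0. Qed.

Lemma houtZ (T : finType) (k : X -> T -> R) (mu : X -> R) m :
  (forall x t, 0 <= k x t) -> 0 <= m -> (forall x, 0 <= mu x) ->
  hout k (fun x => m * mu x) = m * hout k mu.
Proof.
move=> k0 m0 mu0; rewrite /hout -hentZ//; last by move=> t; exact: output_ge0.
apply: eq_hent => t; rewrite /output mulr_sumr.
by apply: eq_bigr => x _; rewrite mulrA.
Qed.

Lemma hout_superadditive (T I : finType) (k : X -> T -> R) (mu : I -> X -> R) :
  (forall x t, 0 <= k x t) -> (forall i x, 0 <= mu i x) ->
  \sum_i hout k (mu i) <= hout k (fun x => \sum_i mu i x).
Proof.
move=> k0 mu0.
apply: le_trans (hent_superadditive (fun i t => output_ge0 t k0 (mu0 i))) _.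
rewrite le_eqVlt; apply/orP; left; apply/eqP/eq_hent => t.
by rewrite exchange_big/=; apply: eq_bigr => x _; rewrite mulr_suml.
Qed.

Lemma noise_le_hout (T : finType) (k : X -> T -> R) (mu : X -> R) :
  (forall x t, 0 <= k x t) -> (forall x, 0 <= mu x) -> noise k mu <= hout k mu.
Proof.
move=> k0 mu0; rewrite /noise (eq_bigr (fun x => hent (fun t => mu x * k x t))).
  by apply: hent_superadditive => x t; exact: mulr_ge0.
by move=> x _; rewrite hentZ.
Qed.

Section Bound.
Variables (W U V : finType).

Definition marg (S : finType) (a : W -> S -> X -> R) w x : R := \sum_s a w s x.

Definition input (S : finType) (a : W -> S -> X -> R) x : R := \sum_w marg a w x.

(* a w u x and b w v x stand for P(W=w,U=u,X=x) and P(W=w,V=v,X=x); the bound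
   depends on the joint law of (U,V,W,X) only through them. *)
Definition aux_data (a : W -> U -> X -> R) (b : W -> V -> X -> R) : Prop :=
  [/\ forall w u x, 0 <= a w u x, forall w v x, 0 <= b w v x,
      forall w x, marg a w x = marg b w x & \sum_x input a x = 1].

(** Here [aY], [aZ] are H(Y|U,W), H(Z|U,W), and [bY], [bZ] are H(Y|V,W), H(Z|V,W). In the sum rates
    [aZ - noise kZ q] is I(X;Z|U,W), which is at least I(V;Z|U,W) and equals it when X is a function
    of (U,V,W). *)
Definition outer_bound (r0 r1 r2 e : R) (a : W -> U -> X -> R)
    (b : W -> V -> X -> R) : Prop :=
  let q := input a in
  let aY := \sum_w \sum_u hout kY (a w u) in
  let aZ := \sum_w \sum_u hout kZ (a w u) in
  let bY := \sum_w \sum_v hout kY (b w v) in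
  let bZ := \sum_w \sum_v hout kZ (b w v) in
  [/\ r0 <= hout kY q - \sum_w hout kY (marg a w) + e,
      r0 <= hout kZ q - \sum_w hout kZ (marg a w) + e &
      [/\ r0 + r1 <= hout kY q - aY + e,
      r0 + r2 <= hout kZ q - bZ + e,
      r0 + r1 + r2 <= hout kY q - aY + aZ - noise kZ q + e &
      r0 + r1 + r2 <= hout kZ q - bZ + bY - noise kY q + e]].

Definition attained (r0 r1 r2 e : R) : Prop :=
  exists a b, aux_data a b /\ outer_bound r0 r1 r2 e a b.

End Bound.

(** The coordinates to preserve are the [#|X|] values of the marginal and the two output entropies.
    By homogeneity, rescaling a slice rescales all of them alike. *)
Lemma reduce_conditional (S : finType) (s0 : S) d (a : S -> X -> R) :
  (#|X| + 2 <= d)%N -> (forall s x, 0 <= a s x) ->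
  exists a' : 'I_d -> X -> R, [/\ forall j x, 0 <= a' j x,
    forall x, \sum_j a' j x = \sum_s a s x,
    \sum_j hout kY (a' j) = \sum_s hout kY (a s) &
    \sum_j hout kZ (a' j) = \sum_s hout kZ (a s)].
Proof.
move=> Xd a0.
pose v s (k : X + bool) := match k with inl x => a s x
  | inr true => hout kY (a s) | inr false => hout kZ (a s) end.
have [|e [m [m0 mv]]] := @caratheodory R _ _ s0 d v; first by rewrite card_sum card_bool.
exists (fun j x => m j * a (e j) x); split.
- by move=> j x; rewrite mulr_ge0.
- by move=> x; rewrite (mv (inl x)).
- by rewrite -(mv (inr true)); apply: eq_bigr => j _; rewrite houtZ.
- by rewrite -(mv (inr false)); apply: eq_bigr => j _; rewrite houtZ.
Qed.

(** U and V can be reduced independently of each other for each [w], because [a] and [b] are linked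
    only through their marginals, and these are preserved. *)
Lemma attained_reduce_conditional (W U V : finType) d r0 r1 r2 e :
  (#|X| + 2 <= d)%N -> attained W U V r0 r1 r2 e ->
  attained W 'I_d 'I_d r0 r1 r2 e.
Proof.
move=> Xd [a [b [[a0 b0 ab a1] B]]].
have [x /sum_neq0_inhabited[w wx]] : exists x, input a x != 0.
  by apply: sum_neq0_inhabited; rewrite a1 oner_eq0.
have [u0 _] := sum_neq0_inhabited wx.
have [v0 _] : exists v, b w v x != 0.
  by apply: sum_neq0_inhabited; rewrite -/(marg b w x) -ab.
move=> {x w wx}.
have /choice[a' a'P] w := reduce_conditional u0 Xd (a0 w).
have /choice[b' b'P] w := reduce_conditional v0 Xd (b0 w).
have aa' w : marg a' w = marg a w by apply/funext => x; have [_ + _ _] := a'P w; apply.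
have bb' w : marg b' w = marg b w by apply/funext => x; have [_ + _ _] := b'P w; apply.
have qq : input a' = input a.
  by apply/funext => x; apply: eq_bigr => w _; rewrite aa'.
exists a', b'; split.
  split; [by move=> w; have [] := a'P w|by move=> w; have [] := b'P w| |by rewrite qq].
  by move=> w x; rewrite aa' bb'.
move: B; rewrite /outer_bound qq.
have sum_eq (T : finType) (k : X -> T -> R) :
  \sum_w hout k (marg a' w) = \sum_w hout k (marg a w).
  by apply: eq_bigr => w _; rewrite aa'.
rewrite !sum_eq.
have -> : \sum_w \sum_u hout kY (a' w u) = \sum_w \sum_u hout kY (a w u).
  by apply: eq_bigr => w _; have [] := a'P w.
have -> : \sum_w \sum_u hout kZ (a' w u) = \sum_w \sum_u hout kZ (a w u).
  by apply: eq_bigr => w _; have [] := a'P w.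
have -> : \sum_w \sum_u hout kY (b' w u) = \sum_w \sum_u hout kY (b w u).
  by apply: eq_bigr => w _; have [] := b'P w.
have -> // : \sum_w \sum_u hout kZ (b' w u) = \sum_w \sum_u hout kZ (b w u).
by apply: eq_bigr => w _; have [] := b'P w.
Qed.

(** [#|X|] coordinates fix the input law; the other six are the sums over [w] in [outer_bound]. The
    slices of [a] and [b] at one [w] get the same weight, so their marginals still agree. *)
Lemma attained_reduce (W U V : finType) d r0 r1 r2 e :
  (#|X| + 6 <= d)%N -> attained W U V r0 r1 r2 e ->
  attained 'I_d U V r0 r1 r2 e.
Proof.
move=> Xd [a [b [[a0 b0 ab a1] B]]].
have [x /sum_neq0_inhabited[w0 _]] : exists x, input a x != 0.
  by apply: sum_neq0_inhabited; rewrite a1 oner_eq0.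
move=> {x}.
pose v w (k : X + 'I_6) := match k with inl x => marg a w x
  | inr i => nth 0 [:: hout kY (marg a w); hout kZ (marg a w);
      \sum_u hout kY (a w u); \sum_u hout kZ (a w u);
      \sum_u hout kY (b w u); \sum_u hout kZ (b w u)] i end.
have [|f [m [m0 mv]]] := @caratheodory R _ _ w0 d v; first by rewrite card_sum card_ord.
pose a' j u x := m j * a (f j) u x; pose b' j u x := m j * b (f j) u x.
have aa' j : marg a' j = fun x => m j * marg a (f j) x.
  by apply/funext => x; rewrite /marg -mulr_sumr.
have bb' j : marg b' j = fun x => m j * marg b (f j) x.
  by apply/funext => x; rewrite /marg -mulr_sumr.
have marg0 w x : 0 <= marg a w x by exact: sumr_ge0.
have qq : input a' = input a.
  apply/funext => x; rewrite /input -[RHS](mv (inl x)).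
  by apply: eq_bigr => j _; rewrite aa'.
exists a', b'; split.
  split; [| | |by rewrite qq].
  - by move=> j u x; rewrite mulr_ge0.
  - by move=> j u x; rewrite mulr_ge0.
  - by move=> j x; rewrite aa' bb' ab.
move: B; rewrite /outer_bound qq.
have transfer (i : 'I_6) (F : W -> R) (F' : 'I_d -> R) :
    (forall w, v w (inr i) = F w) -> (forall j, F' j = m j * F (f j)) ->
    \sum_j F' j = \sum_w F w.
  move=> vF FF'; transitivity (\sum_w v w (inr i)); last exact: eq_bigr.
  by rewrite -mv; apply: eq_bigr => j _; rewrite FF' vF.
have -> : \sum_w hout kY (marg a' w) = \sum_w hout kY (marg a w).
  apply: (transfer (@Ordinal 6 0 isT)) => // j /=; by rewrite aa' houtZ.
have -> : \sum_w hout kZ (marg a' w) = \sum_w hout kZ (marg a w).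
  apply: (transfer (@Ordinal 6 1 isT)) => // j /=; by rewrite aa' houtZ.
have -> : \sum_w \sum_u hout kY (a' w u) = \sum_w \sum_u hout kY (a w u).
  apply: (transfer (@Ordinal 6 2 isT)) => // j /=; rewrite mulr_sumr.
  by apply: eq_bigr => u _; rewrite houtZ.
have -> : \sum_w \sum_u hout kZ (a' w u) = \sum_w \sum_u hout kZ (a w u).
  apply: (transfer (@Ordinal 6 3 isT)) => // j /=; rewrite mulr_sumr.
  by apply: eq_bigr => u _; rewrite houtZ.
have -> : \sum_w \sum_u hout kY (b' w u) = \sum_w \sum_u hout kY (b w u).
  apply: (transfer (@Ordinal 6 4 isT)) => // j /=; rewrite mulr_sumr.
  by apply: eq_bigr => u _; rewrite houtZ.
have -> : \sum_w \sum_u hout kZ (b' w u) = \sum_w \sum_u hout kZ (b w u).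
  apply: (transfer (@Ordinal 6 5 isT)) => // j /=; rewrite mulr_sumr.
  by apply: eq_bigr => u _; rewrite houtZ.
by [].
Qed.

End AuxiliaryData.

(** * Continuity of the bound and removal of the slack *)

Section Compactness.
Variable R : realType.

(** Write log x as 2 log (sqrt x) and bound -log (sqrt x) by 1 / (sqrt x ln 2). This gives
    continuity of [xlog] at 0 from the right. *)
Lemma xlog_le_sqrt (x : R) : 0 <= x -> x <= 1 ->
  `|xlog x| <= 2 / ln 2 * Num.sqrt `|x|.
Proof.
rewrite le_eqVlt => /predU1P[<- _|x0 x1].
  by rewrite xlog0 normr0 mulr_ge0// divr_ge0// ltW// ln2_gt0.
have s0 : 0 < Num.sqrt x by rewrite sqrtr_gt0.
have ss : Num.sqrt x * Num.sqrt x = x by rewrite -expr2 sqr_sqrtr// ltW.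
have l2 := ln2_gt0 R.
have lx : log2 x <= 0 by rewrite /log2 pmulr_lle0 ?invr_gt0// ln_le0.
have nx : xlog x <= 0 by rewrite /xlog pmulr_rle0.
rewrite (ger0_norm (ltW x0)) (ler0_norm nx).
have : log2 (Num.sqrt x)^-1 <= (Num.sqrt x)^-1 / ln 2.
  apply: le_trans (log2_le_sub _) _; first by rewrite invr_gt0.
  by rewrite ler_pM2r ?invr_gt0// gerBl.
rewrite log2V// => h.
rewrite /xlog -[in log2 x]ss log2M//.
have -> : - (x * (log2 (Num.sqrt x) + log2 (Num.sqrt x))) = 2 * x * (- log2 (Num.sqrt x)) by ring.
apply: (@le_trans _ _ (2 * x * ((Num.sqrt x)^-1 / ln 2))).
  by rewrite ler_pM2l// mulr_gt0.
rewrite -{1}ss le_eqVlt; apply/orP; left; apply/eqP.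
by field; rewrite !gt_eqF.
Qed.

(** Stated on the whole line since laws become points of a real vector space. At nonpositive
    arguments [ln] is 0, and so is [xlog]. *)
Lemma xlog_continuous : continuous (@xlog R).
Proof.
move=> x; have l2 := ln2_gt0 R; have [x0|x0|->] := ltrgtP x 0.
- have xlog_neg (y : R) : y < 0 -> xlog y = 0.
    by move=> y0; rewrite /xlog /log2 ln0 ?mul0r ?mulr0// ltW.
  apply: cvg_near_cst; near=> y; rewrite !xlog_neg//.
  by near: y; exact: lt_nbhsl.
- apply: cvgM; first exact: cvg_id.
  by apply: cvgM; [exact: continuous_ln|exact: cvg_cst].
- rewrite /continuous_at xlog0; apply/cvgr0Pnorm_lt => e e0.
  have sc : ((fun y : R => 2 / ln 2 * Num.sqrt `|y|) @ (0 : R) --> (0 : R))%classic.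
    suff : ((fun y : R => Num.sqrt `|y|) @ (0 : R) --> Num.sqrt `|0 : R|)%classic.
      by rewrite normr0 sqrtr0 => /(cvgM (cvg_cst (2 / ln 2 : R))); rewrite mulr0.
    apply: (@continuous_comp _ _ _ (fun y : R => `|y|) Num.sqrt); last exact: sqrt_continuous.
    exact: norm_continuous.
  have /cvgr0Pnorm_lt/(_ _ e0) sce := sc.
  near=> y; have [y0|y0] := leP y 0.
    by rewrite /xlog /log2 ln0// mul0r mulr0 normr0.
  apply: le_lt_trans (xlog_le_sqrt (ltW y0) _) _.
    by near: y; apply: lt_le_nbhsl; rewrite ltr01.
  apply: le_lt_trans (ler_norm _) _.
  by near: y.
Unshelve. all: by end_near. Qed.

Lemma continuous_sum (T : topologicalType) (I : finType) (f : I -> T -> R) :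
  (forall i, continuous (f i)) -> continuous (fun t => \sum_i f i t).
Proof. by move=> fc t; apply: cvg_big => [|i _]; [exact: add_continuous|exact: fc]. Qed.

Lemma hent_continuous (T : topologicalType) (A : finType) (f : A -> T -> R) :
  (forall i, continuous (f i)) -> continuous (fun t => hent (fun i => f i t)).
Proof.
move=> fc t; apply: cvgB.
  apply: (@continuous_comp _ _ _ (fun t => \sum_i f i t) (@xlog R)); last exact: xlog_continuous.
  exact: continuous_sum.
apply: (@continuous_sum _ _ (fun i t => xlog (f i t))) => i s.
by apply: (continuous_comp (fc i s)); exact: xlog_continuous.
Qed.

Variables (X Y Z : finType) (kY : X -> Y -> R) (kZ : X -> Z -> R).

Lemma hout_continuous (T : topologicalType) (A : finType) (k : X -> A -> R)
  (f : T -> X -> R) :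
  (forall x, continuous (f^~ x)) -> continuous (fun t => hout k (f t)).
Proof.
move=> fc; apply: (@hent_continuous _ _ (fun y t => output k (f t) y)) => y.
apply: (@continuous_sum _ _ (fun x t => f t x * k x y)) => x t.
by apply: cvgM; [exact: fc|exact: cvg_cst].
Qed.

Lemma noise_continuous (T : topologicalType) (A : finType) (k : X -> A -> R)
  (f : T -> X -> R) :
  (forall x, continuous (f^~ x)) -> continuous (fun t => noise k (f t)).
Proof.
move=> fc; apply: (@continuous_sum _ _ (fun x t => f t x * hent (k x))) => x t.
by apply: cvgM; [exact: fc|exact: cvg_cst].
Qed.

Variables (W U V : finType).

(** The smallest of the six gaps turns the conjunction into one continuous function, which can be
    maximised. *)
Definition slack (r0 r1 r2 : R) (a : W -> U -> X -> R) (b : W -> V -> X -> R) : R :=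
  let q := input a in
  let aY := \sum_w \sum_u hout kY (a w u) in
  let aZ := \sum_w \sum_u hout kZ (a w u) in
  let bY := \sum_w \sum_v hout kY (b w v) in
  let bZ := \sum_w \sum_v hout kZ (b w v) in
  Num.min (hout kY q - \sum_w hout kY (marg a w) - r0)
 (Num.min (hout kZ q - \sum_w hout kZ (marg a w) - r0)
 (Num.min (hout kY q - aY - (r0 + r1))
 (Num.min (hout kZ q - bZ - (r0 + r2))
 (Num.min (hout kY q - aY + aZ - noise kZ q - (r0 + r1 + r2))
          (hout kZ q - bZ + bY - noise kY q - (r0 + r1 + r2)))))).

Lemma outer_boundE r0 r1 r2 e a b :
  outer_bound kY kZ r0 r1 r2 e a b <-> - e <= slack r0 r1 r2 a b.
Proof.
have E (r s : R) : (r <= s + e) = (- e <= s - r).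
  by rewrite lerBrDr -lerBrDl opprK.
rewrite /outer_bound /slack /= !le_min !E; split.
  by move=> [-> -> [-> -> -> ->]].
by move=> /and5P[-> -> -> -> /andP[-> ->]].
Qed.

Lemma slack_continuous (T : topologicalType) r0 r1 r2
    (a : T -> W -> U -> X -> R) (b : T -> W -> V -> X -> R) :
  (forall w u x, continuous (fun t => a t w u x)) ->
  (forall w v x, continuous (fun t => b t w v x)) ->
  continuous (fun t => slack r0 r1 r2 (a t) (b t)).
Proof.
move=> ac bc.
have mc w x : continuous (fun t => marg (a t) w x).
  by apply: (@continuous_sum _ _ (fun u t => a t w u x)).
have qc x : continuous (fun t => input (a t) x).
  by apply: (@continuous_sum _ _ (fun w t => marg (a t) w x)).
have hq (A : finType) (k : X -> A -> R) : continuous (fun t => hout k (input (a t))).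
  exact: hout_continuous.
have nq (A : finType) (k : X -> A -> R) : continuous (fun t => noise k (input (a t))).
  exact: noise_continuous.
have hm (A : finType) (k : X -> A -> R) : continuous (fun t => \sum_w hout k (marg (a t) w)).
  apply: (@continuous_sum _ _ (fun w t => hout k (marg (a t) w))) => w.
  exact: hout_continuous.
have hs (S A : finType) (k : X -> A -> R) (c : T -> W -> S -> X -> R) :
    (forall w u x, continuous (fun t => c t w u x)) ->
    continuous (fun t => \sum_w \sum_u hout k (c t w u)).
  move=> cc; apply: (@continuous_sum _ _ (fun w t => \sum_u hout k (c t w u))) => w.
  apply: (@continuous_sum _ _ (fun u t => hout k (c t w u))) => u.
  exact: hout_continuous.
move=> t; do 5! try apply: (@continuous_min _ _ (fun t => _) (fun t => _));
  do ?[exact: hq|exact: hm|exact: hs|exact: nq|exact: cvg_cst|apply: cvgD|apply: cvgN].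
Qed.

Lemma attained_limit r0 r1 r2 :
  (forall e, 0 < e -> attained kY kZ W U V r0 r1 r2 e) ->
  attained kY kZ W U V r0 r1 r2 0.
Proof.
move=> att; pose I := ((W * U * X) + (W * V * X))%type.
pose a (s : 'rV[R]_#|{: I}|) w u x := s ord0 (enum_rank (inl (w, u, x) : I)).
pose b (s : 'rV[R]_#|{: I}|) w v x := s ord0 (enum_rank (inr (w, v, x) : I)).
have ac w u x : continuous (fun s => a s w u x) by move=> s; exact: coord_continuous.
have bc w v x : continuous (fun s => b s w v x) by move=> s; exact: coord_continuous.
(* Entries of laws lie in [0,1]. The remaining conditions are closed: [mc] equates the
   (W,X)-marginals and [tot] fixes the total mass. *)
pose box := [set s : 'rV[R]_#|{: I}| | forall i, `[0, 1]%classic (s ord0 i)]%classic.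
pose mc := (\bigcap_(p in [set: W * X])
  (fun s => marg (a s) p.1 p.2 - marg (b s) p.1 p.2) @^-1` [set (0 : R)])%classic.
pose tot := ((fun s => \sum_x input (a s) x) @^-1` [set (1 : R)])%classic.
have margc (S : finType) (c : 'rV[R]_#|{: I}| -> W -> S -> X -> R) w x :
    (forall w u x, continuous (fun t => c t w u x)) ->
    continuous (fun s => marg (c s) w x).
  by move=> cc; apply: (@continuous_sum _ _ (fun u t => c t w u x)).
have closed1 (r : R) : closed [set r]%classic.
  by have := @closed_eq R r; congr closed; apply/seteqP; split.
have cA : compact (box `&` (mc `&` tot))%classic.
  apply: compact_closedI.
    by apply: (@rV_compact R _ (fun=> `[0, 1]%classic)) => i; exact: segment_compact.
  apply: closedI.
    apply: closed_bigI => p _; apply: closed_comp => // s _.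
    exact: (cvgB (margc _ a p.1 p.2 ac s) (margc _ b p.1 p.2 bc s)).
  apply: closed_comp => // s _; apply: (@continuous_sum _ _ (fun x s => input (a s) x)) => x.
  by apply: (@continuous_sum _ _ (fun w s => marg (a s) w x)) => w; exact: (margc _ a w x ac).
have emb (a' : W -> U -> X -> R) (b' : W -> V -> X -> R) : aux_data a' b' ->
    exists2 s, (box `&` (mc `&` tot))%classic s & a s = a' /\ b s = b'.
  move=> [a0 b0 ab a1].
  have m0 w x : 0 <= marg a' w x by exact: sumr_ge0.
  have q0 x : 0 <= input a' x by exact: sumr_ge0.
  have m1 w x : marg a' w x <= 1.
    apply: (@le_trans _ _ (input a' x)); first by rewrite /input (bigD1 w)//= lerDl sumr_ge0.
    by rewrite -a1 (bigD1 x)//= lerDl sumr_ge0.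
  have a'1 w u x : a' w u x <= 1.
    by apply: le_trans (m1 w x); rewrite /marg (bigD1 u)//= lerDl sumr_ge0.
  have b'1 w v x : b' w v x <= 1.
    by apply: le_trans (m1 w x); rewrite ab /marg (bigD1 v)//= lerDl sumr_ge0.
  pose s : 'rV[R]_#|{: I}| := \row_i match enum_val i with
    inl (w, u, x) => a' w u x | inr (w, v, x) => b' w v x end.
  have sa : a s = a'.
    by apply/funext => w; apply/funext => u; apply/funext => x; rewrite /a mxE enum_rankK.
  have sb : b s = b'.
    by apply/funext => w; apply/funext => u; apply/funext => x; rewrite /b mxE enum_rankK.
  exists s => //; split.
    move=> i; rewrite /= mxE in_itv/=.
    by case: (enum_val i) => -[[w u] x]; rewrite ?a0 ?a'1 ?b0 ?b'1.
  split=> [[w x] _|]; first by rewrite /= sa sb ab subrr.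
  by rewrite /tot /preimage /mkset sa a1.
have proj s : (box `&` (mc `&` tot))%classic s -> aux_data (a s) (b s).
  move=> [sbox [smc stot]]; split=> //.
  - by move=> w u x; have := sbox (enum_rank (inl (w, u, x) : I)); rewrite /= in_itv/= => /andP[].
  - by move=> w u x; have := sbox (enum_rank (inr (w, u, x) : I)); rewrite /= in_itv/= => /andP[].
  - by move=> w x; apply/eqP; rewrite -subr_eq0; apply/eqP; exact: (smc (w, x)).
have A0 : (box `&` (mc `&` tot) !=set0)%classic.
  have [a' [b' [/emb[s sA _] _]]] := att _ ltr01; by exists s.
have [|s sA smax] := @EVT_max_rV R _ (fun s => slack r0 r1 r2 (a s) (b s)) _ A0 cA.
  by apply: continuous_subspaceT; exact: slack_continuous.
exists (a s), (b s); split; first by apply: proj; exact/set_mem.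
apply/outer_boundE; rewrite oppr0 leNgt; apply/negP => neg.
(* Half of the supposed deficit: the resulting point has a strictly larger slack than the
   maximiser. *)
have [a' [b' [/emb[t tA [ta tb]]]]] := att (- slack r0 r1 r2 (a s) (b s) / 2) ltac:(lra).
rewrite -ta -tb => /outer_boundE; have := smax t (mem_set tA).
by move=> /=; lra.
Qed.

End Compactness.

(** * Entropies of channel outputs and information quantities *)

Section ChannelEntropy.
Variables (R : realType) (Omega : finType) (P : Omega -> R).
Hypotheses (P0 : forall o, 0 <= P o) (P1 : \sum_o P o = 1).

Lemma law_ind (T : finType) (f : Omega -> T) t :
  law P f t = \sum_o P o * (f o == t)%:R.
Proof.
rewrite /law big_mkcond/=; apply: eq_bigr => o _.
by case: eqP; rewrite ?mulr1 ?mulr0.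
Qed.

Variables (X T B : finType) (k : X -> T -> R) (f : Omega -> T) (xi : Omega -> X)
  (g : Omega -> B).

(** The Markov chain [g], [xi], [f] with transition [k], expressed by joint laws so that no
    conditional probability occurs. *)
Definition through_channel : Prop := forall t b,
  law P (fun o => (f o, g o)) (t, b) = output k (fun x => law P (fun o => (xi o, g o)) (x, b)) t.

Hypothesis fk : through_channel.

Lemma cent_channel :
  cent P f g = \sum_b hout k (fun x => law P (fun o => (xi o, g o)) (x, b)).
Proof.
by rewrite centE; apply: eq_bigr => b _; apply: eq_hent => t; rewrite fk.
Qed.

Lemma law_pairl (A : finType) (h : Omega -> A) t :
  \sum_b law P (fun o => (h o, g o)) (t, b) = law P h t.
Proof.
by rewrite /law [RHS](partition_big g xpredT)//=; apply: eq_bigr.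
Qed.

Lemma entropy_channel : entropy P f = hout k (law P xi).
Proof.
have lawf t : law P f t = output k (law P xi) t.
  rewrite -law_pairl /output.
  under [RHS]eq_bigr => x _ do rewrite -law_pairl mulr_suml.
  by rewrite exchange_big/=; apply: eq_bigr => b _; rewrite fk.
rewrite /hout -(eq_hent lawf) /hent law_total P1 xlog1 sub0r.
by [].
Qed.

End ChannelEntropy.

Section InformationAsConditionalEntropy.
Variables (R : realType) (Omega : finType) (P : Omega -> R).

Lemma cent_swap (A B : finType) (f : Omega -> A) (g : Omega -> B) :
  entropy P f - cent P f g = entropy P g - cent P g f.
Proof.
have e : entropy P (fun o => (f o, g o)) = entropy P (fun o => (g o, f o)).
  by apply: entropy_ker => o o'; rewrite !xpair_eqE andbC.
by rewrite /cent e; ring.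
Qed.

Lemma mutinfoE (A B : finType) (f : Omega -> A) (g : Omega -> B) :
  mutinfo P f g = entropy P g - cent P g f.
Proof. by rewrite -cent_swap /mutinfo /cent; ring. Qed.

Lemma cmutinfoE (A B C : finType) (f : Omega -> A) (g : Omega -> B) (h : Omega -> C) :
  cmutinfo P f g h = cent P g h - cent P g (fun o => (f o, h o)).
Proof.
have e : entropy P (fun o => (g o, (f o, h o))) = entropy P (fun o => (f o, g o, h o)).
  by apply: entropy_ker => o o'; rewrite !xpair_eqE andbCA andbA.
by rewrite /cmutinfo /cent e; ring.
Qed.

End InformationAsConditionalEntropy.

Lemma sum_pair (V : nmodType) (A B : finType) (F : A * B -> V) :
  \sum_p F p = \sum_a \sum_b F (a, b).
Proof. by rewrite pair_bigA; apply: eq_bigr => -[]. Qed.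

(** * One use of the channel *)

Section SingleLetter.
Variables (R : realType) (S X Y Z : finType) (J : S * X -> R) (ch : X -> Y -> Z -> R).
Hypotheses (J0 : forall sx, 0 <= J sx) (J1 : \sum_sx J sx = 1) (Hch : is_bc_channel ch).

Definition chanY x y : R := \sum_z ch x y z.
Definition chanZ x z : R := \sum_y ch x y z.

Definition joint (o : S * X * Y * Z) : R := J o.1.1 * ch o.1.1.2 o.1.2 o.2.

Lemma sum_joint (F : S * X * Y * Z -> R) :
  \sum_o joint o * F o =
  \sum_s \sum_x \sum_y \sum_z J (s, x) * ch x y z * F (s, x, y, z).
Proof.
by rewrite !sum_pair.
Qed.

Lemma joint_ge0 o : 0 <= joint o.
Proof. by case: Hch => ch0 _; rewrite /joint mulr_ge0. Qed.

Lemma law_joint_input (T : finType) (phi : S * X -> T) t :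
  law joint (fun o => phi o.1.1) t = law J phi t.
Proof.
case: Hch => _ ch1; rewrite law_ind sum_joint law_ind.
rewrite sum_pair.
apply: eq_bigr => s _; apply: eq_bigr => x _.
rewrite /=; under eq_bigr do rewrite -mulr_suml -mulr_sumr.
by rewrite -mulr_suml -mulr_sumr ch1 mulr1.
Qed.

Lemma joint_total : \sum_o joint o = 1.
Proof.
rewrite -(law_total joint (fun o => (fun=> tt) o.1.1)).
transitivity (\sum_t law J (fun=> tt) t); last by rewrite law_total.
by apply: eq_bigr => t _; exact: (law_joint_input (fun=> tt)).
Qed.

Lemma through_chanY (B : finType) (phi : S -> B) :
  through_channel joint chanY (fun o => o.1.2) (fun o => o.1.1.2) (fun o => phi o.1.1.1).
Proof.
move=> y b; rewrite law_ind sum_joint exchange_big/= /output; apply: eq_bigr => x _.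
rewrite (law_joint_input (fun sx => (sx.2, phi sx.1))) law_ind mulr_suml.
rewrite sum_pair.
apply: eq_bigr => s _; rewrite (bigD1 x)//= [X in _ = _ + X]big1 ?addr0; last first.
  by move=> x' /negbTE xx; rewrite xpair_eqE xx mulr0 mul0r.
rewrite (bigD1 y)//= [X in _ + X]big1 ?addr0; last first.
  by move=> y' /negbTE yy; rewrite big1// => z _; rewrite xpair_eqE yy mulr0.
by rewrite -mulr_suml -mulr_sumr !xpair_eqE !eqxx/= mulrAC.
Qed.

Lemma through_chanZ (B : finType) (phi : S -> B) :
  through_channel joint chanZ (fun o => o.2) (fun o => o.1.1.2) (fun o => phi o.1.1.1).
Proof.
move=> z b; rewrite law_ind sum_joint exchange_big/= /output; apply: eq_bigr => x _.
rewrite (law_joint_input (fun sx => (sx.2, phi sx.1))) law_ind mulr_suml.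
rewrite sum_pair.
apply: eq_bigr => s _; rewrite (bigD1 x)//= [X in _ = _ + X]big1 ?addr0; last first.
  by move=> x' /negbTE xx; rewrite xpair_eqE xx mulr0 mul0r.
rewrite exchange_big/= (bigD1 z)//= [X in _ + X]big1 ?addr0; last first.
  by move=> z' /negbTE zz; rewrite big1// => y _; rewrite xpair_eqE zz mulr0.
by rewrite -mulr_suml -mulr_sumr !xpair_eqE !eqxx/= mulrAC.
Qed.

(** A slice carried by one letter produces a multiple of one row of the channel. This is how an
    input determined by (U,V,W) makes H(Z|U,V,W) equal to H(Z|X). *)
Lemma hout_point (T : finType) (k : X -> T -> R) (mu : X -> R) x0 :
  (forall x t, 0 <= k x t) -> (forall x, 0 <= mu x) -> (forall x, x != x0 -> mu x = 0) ->
  hout k mu = noise k mu.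
Proof.
move=> k0 mu0 mu1; rewrite /noise (bigD1 x0)//= big1 ?addr0 => [|x /mu1 ->]; last by rewrite mul0r.
rewrite -hentZ//; apply: eq_hent => t.
by rewrite /output (bigD1 x0)//= big1 ?addr0// => x /mu1 ->; rewrite mul0r.
Qed.

End SingleLetter.

Lemma triple_eq (A B C : eqType) (s t : A * B * C) :
  ((s.1.1, (s.1.2, s.2)) == (t.1.1, (t.1.2, t.2))) = (s == t).
Proof. by case: s t => [[s1 s2] s3] [[t1 t2] t3]; rewrite !xpair_eqE andbA. Qed.

Lemma triple_swap_eq (A B C : eqType) (s t : A * B * C) :
  ((s.1.2, (s.1.1, s.2)) == (t.1.2, (t.1.1, t.2))) = (s == t).
Proof.
by case: s t => [[s1 s2] s3] [[t1 t2] t3]; rewrite !xpair_eqE andbCA andbA.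
Qed.

(** * One-time pads over cyclic groups *)

Section SumsOverGroups.
Variables (R : pzRingType) (F : finZmodType).

Lemma sum_shift (T : F -> R) c : \sum_u T (u - c) = \sum_u T u.
Proof. by rewrite [RHS](reindex_inj (addIr (- c))). Qed.

Lemma sum_revshift (T : F -> R) c : \sum_u T (c - u) = \sum_u T u.
Proof. by rewrite [RHS](reindex_inj (subrI c)). Qed.

Lemma sum_delta (c g : F) : \sum_l (c + l == g)%:R = 1 :> R.
Proof.
rewrite (bigD1 (g - c))//= subrKC eqxx big1 ?addr0// => l /negbTE lg.
by rewrite eq_sym addrC -subr_eq eq_sym lg.
Qed.

End SumsOverGroups.

Lemma sum_const_ord (R : pzSemiRingType) n (c : R) : \sum_(i < n) c = n%:R * c.
Proof. by rewrite sumr_const card_ord mulr_natl. Qed.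

(** [x], [y], [z] are the orders of the groups masking U, V and X; the density of the two keys
    cancels against the number of masked copies of a slice. *)
Lemma cancel_masks (F : fieldType) (x y z s : F) : x != 0 -> y != 0 -> z != 0 ->
  (x * z)^-1 * (y * z)^-1 * (z * (z * (y * (x * s)))) = s.
Proof. by move=> x0 y0 z0; field; rewrite x0 y0 z0. Qed.

Section Padding.
Variables (R : realType) (X Y Z : finType) (ch : X -> Y -> Z -> R).
Hypothesis Hch : is_bc_channel ch.
Variables (W : finType) (dU dV : nat).
Variables (a : W -> 'I_dU.+1 -> X -> R) (b : W -> 'I_dV.+1 -> X -> R).
Hypotheses (a0 : forall w u x, 0 <= a w u x) (b0 : forall w v x, 0 <= b w v x)
  (ab : forall w x, marg a w x = marg b w x) (a1 : \sum_x input a x = 1).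

Let kY := chanY ch.
Let kZ := chanZ ch.

(** Embeds the alphabet in a cyclic group, where keys can be added. The successor in the order
    provides the group structure without knowing that [X] is inhabited. *)
Definition code (x : X) : 'I_#|X|.+1 := widen_ord (leqnSn _) (enum_rank x).

Lemma code_inj : injective code.
Proof.
by move=> x x' /(congr1 (@nat_of_ord _)) e; apply: enum_rank_inj; exact: val_inj.
Qed.

(* Couples a and b by making U and V conditionally independent given (W,X). *)
Definition coupling w u v x : R := a w u x * b w v x / marg a w x.

Lemma coupling_ge0 w u v x : 0 <= coupling w u v x.
Proof. by rewrite /coupling divr_ge0 ?mulr_ge0// sumr_ge0. Qed.

Lemma sum_coupling_v w u x : \sum_v coupling w u v x = a w u x.
Proof.
rewrite /coupling -mulr_suml -mulr_sumr -/(marg b w x) -ab.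
have [c0|c0] := eqVneq (marg a w x) 0; last by rewrite mulfK.
(* On a slice of mass 0 the quotient is 0 by convention, and so is [a], being a nonnegative summand
   of a zero sum. *)
rewrite c0 invr0 mulr0; apply/esym/eqP.
by have /eqP := c0; rewrite psumr_eq0// => /allP/(_ u (mem_index_enum _)).
Qed.

Lemma sum_coupling_u w v x : \sum_u coupling w u v x = b w v x.
Proof.
rewrite /coupling -mulr_suml -mulr_suml -/(marg a w x).
have [c0|c0] := eqVneq (marg a w x) 0; last by rewrite mulrAC divff// mul1r.
rewrite c0 invr0 mulr0; apply/esym/eqP.
by have /eqP := c0; rewrite ab psumr_eq0// => /allP/(_ v (mem_index_enum _)).
Qed.

(* Joint law of W' = (W, U + K1, V + K2, code X + K + L) and X given the keys
   U' = (K1,K) and V' = (K2,L).  With independent uniform keys, W' reveals only W,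
   (U',W') only (W,U) and (V',W') only (W,V), while (U',V',W') determines X. *)
Definition masked (u' : 'I_dU.+1 * 'I_#|X|.+1) (v' : 'I_dV.+1 * 'I_#|X|.+1)
  (w' : W * 'I_dU.+1 * 'I_dV.+1 * 'I_#|X|.+1) x : R :=
  coupling w'.1.1.1 (w'.1.1.2 - u'.1) (w'.1.2 - v'.1) x *
  (code x + u'.2 + v'.2 == w'.2)%:R.

Lemma masked_ge0 u' v' w' x : 0 <= masked u' v' w' x.
Proof. by rewrite mulr_ge0 ?coupling_ge0 ?ler0n. Qed.

Lemma sum_masked_v u' w' x : \sum_v' masked u' v' w' x = a w'.1.1.1 (w'.1.1.2 - u'.1) x.
Proof.
rewrite sum_pair /masked/=.
under eq_bigr do rewrite -mulr_sumr sum_delta mulr1.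
by rewrite (sum_revshift (fun v => coupling _ _ v _)) sum_coupling_v.
Qed.

Lemma sum_masked_u v' w' x : \sum_u' masked u' v' w' x = b w'.1.1.1 (w'.1.2 - v'.1) x.
Proof.
rewrite sum_pair /masked/=.
under eq_bigr => k1 _.
  rewrite -mulr_sumr; under eq_bigr do rewrite addrAC.
  rewrite sum_delta mulr1; over.
by rewrite (sum_revshift (fun u => coupling _ u _ _)) sum_coupling_u.
Qed.

Let nG : R := #|X|.+1%:R.
Let nU : R := dU.+1%:R.
Let nV : R := dV.+1%:R.

(** The result is the same for all keys, so [masked] is a conditional law given keys that are
    independent of each other and of X. *)
Lemma sum_masked_w u' v' x : \sum_w' masked u' v' w' x = input a x.
Proof.
rewrite sum_pair /masked/=.
under eq_bigr => w' _.
  rewrite -mulr_sumr (_ : \sum_g _ = 1) ?mulr1; last first.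
    rewrite (bigD1 (code x + u'.2 + v'.2))//= eqxx big1 ?addr0// => g /negbTE.
    by rewrite eq_sym => ->.
  over.
rewrite 2!sum_pair/= /input; apply: eq_bigr => w _.
under eq_bigr do rewrite (sum_shift (fun v => coupling w _ v x)) sum_coupling_v.
by rewrite (sum_shift (fun u => a w u x)).
Qed.

Lemma sum_masked_uv w' x : \sum_u' \sum_v' masked u' v' w' x = nG * marg a w'.1.1.1 x.
Proof.
under eq_bigr do rewrite sum_masked_v.
rewrite sum_pair/=; under eq_bigr do rewrite sum_const_ord.
by rewrite -mulr_sumr (sum_revshift (fun u => a _ u _)).
Qed.

Let nu : R := (nU * nG)^-1 * (nV * nG)^-1.

Let nG0 : nG != 0. Proof. by rewrite pnatr_eq0. Qed.
Let nU0 : nU != 0. Proof. by rewrite pnatr_eq0. Qed.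
Let nV0 : nV != 0. Proof. by rewrite pnatr_eq0. Qed.
Let nu0 : 0 <= nu. Proof. by rewrite mulr_ge0// invr_ge0 mulr_ge0 ?ler0n. Qed.

Definition padded (sx : ('I_dU.+1 * 'I_#|X|.+1) * ('I_dV.+1 * 'I_#|X|.+1) *
    (W * 'I_dU.+1 * 'I_dV.+1 * 'I_#|X|.+1) * X) : R :=
  nu * masked sx.1.1.1 sx.1.1.2 sx.1.2 sx.2.

Lemma padded_ge0 sx : 0 <= padded sx.
Proof. by rewrite mulr_ge0 ?masked_ge0. Qed.

Lemma law_padded (T : finType) (phi : _ -> T) x t :
  law padded (fun sx => (sx.2, phi sx.1)) (x, t) =
  \sum_u' \sum_v' \sum_w' nu * masked u' v' w' x * (phi (u', v', w') == t)%:R.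
Proof.
rewrite law_ind 3!sum_pair; do 3! (apply: eq_bigr => ? _).
rewrite (bigD1 x)//= [X in _ + X]big1 ?addr0; last first.
  by move=> x' /negbTE xx; rewrite xpair_eqE xx mulr0.
by rewrite xpair_eqE eqxx.
Qed.

Lemma law_padded_w x w' :
  law padded (fun sx => (sx.2, sx.1.2)) (x, w') = nu * nG * marg a w'.1.1.1 x.
Proof.
rewrite (law_padded (fun s => s.2)) -mulrA -sum_masked_uv mulr_sumr.
apply: eq_bigr => u' _; rewrite mulr_sumr; apply: eq_bigr => v' _.
rewrite (bigD1 w')//= eqxx mulr1 big1 ?addr0// => w'' /negbTE ->.
by rewrite mulr0.
Qed.

Lemma law_padded_uw x u' w' :
  law padded (fun sx => (sx.2, (sx.1.1.1, sx.1.2))) (x, (u', w')) =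
  nu * a w'.1.1.1 (w'.1.1.2 - u'.1) x.
Proof.
rewrite (law_padded (fun s => (s.1.1, s.2))) -sum_masked_v mulr_sumr.
rewrite (bigD1 u')//= [X in _ + X]big1 ?addr0; last first.
  move=> u'' /negbTE uu; rewrite big1// => v' _; rewrite big1// => w'' _.
  by rewrite xpair_eqE uu mulr0.
apply: eq_bigr => v' _.
rewrite (bigD1 w')//= eqxx mulr1 big1 ?addr0// => w'' /negbTE ww.
by rewrite xpair_eqE ww andbF mulr0.
Qed.

Lemma law_padded_vw x v' w' :
  law padded (fun sx => (sx.2, (sx.1.1.2, sx.1.2))) (x, (v', w')) =
  nu * b w'.1.1.1 (w'.1.2 - v'.1) x.
Proof.
rewrite (law_padded (fun s => (s.1.2, s.2))) -sum_masked_u mulr_sumr.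
apply: eq_bigr => u' _.
rewrite (bigD1 v')//= [X in _ + X]big1 ?addr0; last first.
  by move=> v'' /negbTE uu; rewrite big1// => w'' _; rewrite xpair_eqE uu mulr0.
rewrite (bigD1 w')//= eqxx mulr1 big1 ?addr0// => w'' /negbTE ww.
by rewrite xpair_eqE ww andbF mulr0.
Qed.

Lemma law_padded_s x s :
  law padded (fun sx => (sx.2, sx.1)) (x, s) = padded (s, x).
Proof.
by rewrite /law (big_pred1 (s, x))// => -[s' x'] /=; rewrite !xpair_eqE andbC.
Qed.

Lemma sum_padW (F : W -> R) :
  \sum_(w' : W * 'I_dU.+1 * 'I_dV.+1 * 'I_#|X|.+1) F w'.1.1.1 =
  nG * (nV * (nU * \sum_w F w)).
Proof.
rewrite sum_pair/=; under eq_bigr do rewrite sum_const_ord.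
rewrite -mulr_sumr sum_pair/=; under eq_bigr do rewrite sum_const_ord.
rewrite -mulr_sumr sum_pair/=; under eq_bigr do rewrite sum_const_ord.
by rewrite -mulr_sumr.
Qed.

Lemma law_padded_x x : law padded snd x = input a x.
Proof.
rewrite -(law_pairl padded (fun sx => sx.1.2)).
under eq_bigr do rewrite law_padded_w.
rewrite -mulr_sumr (sum_padW (fun w => marg a w x)) -/(input a x) -mulrA /nu.
by rewrite cancel_masks.
Qed.

Lemma padded_total : \sum_sx padded sx = 1.
Proof.
by rewrite -(law_total padded snd); under eq_bigr do rewrite law_padded_x.
Qed.

Section Outputs.
Variables (T : finType) (k : X -> T -> R).
Hypothesis k0 : forall x t, 0 <= k x t.

(** Each slice reappears once for every choice of masks, weighted by the inverse of their number;
    homogeneity reassembles it. *)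
Lemma hout_padded_w :
  \sum_w' hout k (fun x => law padded (fun sx => (sx.2, sx.1.2)) (x, w')) =
  \sum_w hout k (marg a w).
Proof.
transitivity (\sum_(w' : W * 'I_dU.+1 * 'I_dV.+1 * 'I_#|X|.+1)
  nu * (nG * hout k (marg a w'.1.1.1))).
  apply: eq_bigr => w' _; rewrite mulrA -houtZ//; last 2 first.
  - by rewrite mulr_ge0// ler0n.
  - by move=> x; exact: sumr_ge0.
  by congr hout; apply/funext => x; rewrite law_padded_w.
rewrite -2!mulr_sumr (sum_padW (fun w => hout k (marg a w))) /nu.
by rewrite cancel_masks.
Qed.

Lemma hout_padded_uw :
  \sum_uw hout k (fun x => law padded (fun sx => (sx.2, (sx.1.1.1, sx.1.2))) (x, uw)) =
  \sum_w \sum_u hout k (a w u).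
Proof.
transitivity (\sum_(uw : ('I_dU.+1 * 'I_#|X|.+1) * (W * 'I_dU.+1 * 'I_dV.+1 * 'I_#|X|.+1))
  nu * hout k (a uw.2.1.1.1 (uw.2.1.1.2 - uw.1.1))).
  apply: eq_bigr => -[u' w'] _; rewrite -houtZ//.
  by congr hout; apply/funext => x; rewrite law_padded_uw.
rewrite -mulr_sumr sum_pair exchange_big/=.
under eq_bigr => w' _.
  rewrite sum_pair/=; under eq_bigr do rewrite sum_const_ord.
  rewrite -mulr_sumr (sum_revshift (fun u => hout k (a _ u))); over.
rewrite -mulr_sumr (sum_padW (fun w => \sum_u hout k (a w u))) /nu.
by rewrite cancel_masks.
Qed.

Lemma hout_padded_vw :
  \sum_vw hout k (fun x => law padded (fun sx => (sx.2, (sx.1.1.2, sx.1.2))) (x, vw)) =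
  \sum_w \sum_v hout k (b w v).
Proof.
transitivity (\sum_(vw : ('I_dV.+1 * 'I_#|X|.+1) * (W * 'I_dU.+1 * 'I_dV.+1 * 'I_#|X|.+1))
  nu * hout k (b vw.2.1.1.1 (vw.2.1.2 - vw.1.1))).
  apply: eq_bigr => -[v' w'] _; rewrite -houtZ//.
  by congr hout; apply/funext => x; rewrite law_padded_vw.
rewrite -mulr_sumr sum_pair exchange_big/=.
under eq_bigr => w' _.
  rewrite sum_pair/=; under eq_bigr do rewrite sum_const_ord.
  rewrite -mulr_sumr (sum_revshift (fun v => hout k (b _ v))); over.
rewrite -mulr_sumr (sum_padW (fun w => \sum_u hout k (b w u))) /nu.
by rewrite cancel_masks.
Qed.

Variable x0 : X.

(** The default [x0] provides a law of X also at triples (u,v,w) that encode no letter. *)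
Definition decode (g : 'I_#|X|.+1) : X := odflt x0 [pick x | code x == g].

Lemma masked_decode u' v' w' x :
  x != decode (w'.2 - v'.2 - u'.2) -> masked u' v' w' x = 0.
Proof.
move=> xd; rewrite /masked; case: eqP => [e|_]; last by rewrite mulr0.
move: xd; rewrite -e addrK addrK /decode; case: pickP => [y /eqP/code_inj -> /=|/(_ x)].
  by rewrite eqxx.
by rewrite eqxx.
Qed.

(** Removing both keys from the last coordinate of W' recovers X, so every slice is a point mass.
    This makes the relaxed residual term of [outer_bound] exact. *)
Lemma hout_padded_s :
  \sum_s hout k (fun x => law padded (fun sx => (sx.2, sx.1)) (x, s)) =
  noise k (input a).
Proof.
transitivity (\sum_s noise k (fun x => law padded (fun sx => (sx.2, sx.1)) (x, s))).
  apply: eq_bigr => s _; apply: (@hout_point _ _ _ _ _ (decode (s.2.2 - s.1.2.2 - s.1.1.2))) => //.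
  - by move=> x; rewrite law_padded_s padded_ge0.
  - by move=> x xd; rewrite law_padded_s /padded/= masked_decode// mulr0.
rewrite /noise exchange_big/=; apply: eq_bigr => x _.
by rewrite -mulr_suml (law_pairl padded) law_padded_x.
Qed.

End Outputs.

Lemma padding r0 r1 r2 : outer_bound kY kZ r0 r1 r2 0 a b ->
  exists (U V W : finType) (pU : U -> R) (pV : V -> R)
         (pW : U -> V -> W -> R) (pX : U -> V -> W -> X -> R),
    is_pmf pU /\ is_pmf pV /\
    (forall u v, is_pmf (pW u v)) /\ (forall u v w, is_pmf (pX u v w)) /\
    let P := fun o : U * V * W * X * Y * Z =>
      let: (u, v, w, x, y, z) := o in
      pU u * pV v * pW u v w * pX u v w x * ch x y z in
    let rU := fun o : U * V * W * X * Y * Z => o.1.1.1.1.1 in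
    let rV := fun o : U * V * W * X * Y * Z => o.1.1.1.1.2 in
    let rW := fun o : U * V * W * X * Y * Z => o.1.1.1.2 in
    let rY := fun o : U * V * W * X * Y * Z => o.1.2 in
    let rZ := fun o : U * V * W * X * Y * Z => o.2 in
    let rUW := fun o => (rU o, rW o) in
    let rVW := fun o => (rV o, rW o) in
    r0 <= Num.min (mutinfo P rW rY) (mutinfo P rW rZ) /\
    r0 + r1 <= mutinfo P rUW rY /\
    r0 + r2 <= mutinfo P rVW rZ /\
    r0 + r1 + r2 <= mutinfo P rUW rY + cmutinfo P rV rZ rUW /\
    r0 + r1 + r2 <= mutinfo P rVW rZ + cmutinfo P rU rY rVW.
Proof.
move=> [B1 B2 [B3 B4 B5 B6]].
have [x0 _] : exists x, input a x != 0.
  by apply: sum_neq0_inhabited; rewrite a1 oner_eq0.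
(* The keys are uniform, the law of W' is the masked mass with X summed out, and X is decoded. As
   [masked] is carried by the decoded letter, the product of these laws is [padded]. *)
exists ('I_dU.+1 * 'I_#|X|.+1)%type, ('I_dV.+1 * 'I_#|X|.+1)%type,
  (W * 'I_dU.+1 * 'I_dV.+1 * 'I_#|X|.+1)%type,
  (fun=> (nU * nG)^-1), (fun=> (nV * nG)^-1), (fun u v w => \sum_x masked u v w x),
  (fun u v w x => (x == decode x0 (w.2 - v.2 - u.2))%:R).
split.
  split=> [_|]; first by rewrite invr_ge0 mulr_ge0// ler0n.
  by rewrite sum_pair/= !sum_const_ord mulrA divff// mulf_neq0.
split.
  split=> [_|]; first by rewrite invr_ge0 mulr_ge0// ler0n.
  by rewrite sum_pair/= !sum_const_ord mulrA divff// mulf_neq0.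
split.
  move=> u v; split=> [w|]; first by rewrite sumr_ge0// => x _; exact: masked_ge0.
  rewrite exchange_big/= -a1; apply: eq_bigr => x _.
  exact: sum_masked_w.
split.
  move=> u v w; split=> [x|]; first exact: ler0n.
  by rewrite (bigD1 (decode x0 (w.2 - v.2 - u.2)))//= eqxx big1 ?addr0// => x /negbTE ->.
set P := (fun o => _).
have PE : P = joint padded ch.
  apply/funext => -[[[[[u v] w] x] y] z] /=; rewrite /joint /padded /=; congr (_ * _).
  rewrite -!mulrA; congr (_ * (_ * _)).
  rewrite (bigD1 (decode x0 (w.2 - v.2 - u.2)))//= big1 ?addr0; last first.
    by move=> x' xd; exact: masked_decode xd.
  have [->|xd] := eqVneq; first by rewrite mulr1.
  by rewrite mulr0 (masked_decode xd).
cbv zeta; rewrite PE => {P PE}.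
have J0 := padded_ge0; have J1 := padded_total.
have P0 := joint_ge0 J0 Hch; have P1 := joint_total J1 Hch.
have kY0 x y : 0 <= kY x y by case: Hch => ch0 _; exact: sumr_ge0.
have kZ0 x z : 0 <= kZ x z by case: Hch => ch0 _; exact: sumr_ge0.
have lawX : law (joint padded ch) (fun o => o.1.1.2) = input a.
  by apply/funext => x; rewrite (law_joint_input padded Hch snd) law_padded_x.
have HY := entropy_channel P1 (through_chanY padded Hch id).
have HZ := entropy_channel P1 (through_chanZ padded Hch id).
rewrite lawX in HY; rewrite lawX in HZ.
have CY (B : finType) (phi : _ -> B) : cent (joint padded ch) (fun o => o.1.2) (fun o => phi o.1.1.1)
    = \sum_t hout kY (fun x => law padded (fun sx => (sx.2, phi sx.1)) (x, t)).
  rewrite (cent_channel (through_chanY padded Hch phi)); apply: eq_bigr => t _.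
  by congr hout; apply/funext => x; rewrite (law_joint_input padded Hch (fun sx => (sx.2, phi sx.1))).
have CZ (B : finType) (phi : _ -> B) : cent (joint padded ch) (fun o => o.2) (fun o => phi o.1.1.1)
    = \sum_t hout kZ (fun x => law padded (fun sx => (sx.2, phi sx.1)) (x, t)).
  rewrite (cent_channel (through_chanZ padded Hch phi)); apply: eq_bigr => t _.
  by congr hout; apply/funext => x; rewrite (law_joint_input padded Hch (fun sx => (sx.2, phi sx.1))).
rewrite le_min !mutinfoE !cmutinfoE HY HZ.
rewrite (CY _ snd) (CZ _ snd) (CY _ (fun s => (s.1.1, s.2))) (CZ _ (fun s => (s.1.1, s.2))).
rewrite (CY _ (fun s => (s.1.2, s.2))) (CZ _ (fun s => (s.1.2, s.2))).
rewrite (cent_ker _ _ (fun o o' => triple_swap_eq o.1.1.1 o'.1.1.1)).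
rewrite (cent_ker _ _ (fun o o' => triple_eq o.1.1.1 o'.1.1.1)) (CY _ id) (CZ _ id).
rewrite !hout_padded_w// !hout_padded_uw// !hout_padded_vw// !(hout_padded_s _ x0)//.
rewrite !addr0 in B1 B2 B3 B4 B5 B6.
rewrite B1 B2; split=> //; split=> //; split=> //; split; rewrite ?addrA; lra.
Qed.

End Padding.

(** * The n-letter converse for a fixed code *)

Section Code.
Variables (R : realType) (X Y Z : finType) (ch : X -> Y -> Z -> R).
Hypothesis Hch : is_bc_channel ch.
Variables (n : nat) (M0 M1 M2 : finType) (enc : M0 * M1 * M2 -> 'I_n -> X).

Let kY := chanY ch.
Let kZ := chanZ ch.

Lemma chanY_ge0 x y : 0 <= kY x y.
Proof. by case: Hch => ch0 _; exact: sumr_ge0. Qed.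

Lemma chanZ_ge0 x z : 0 <= kZ x z.
Proof. by case: Hch => ch0 _; exact: sumr_ge0. Qed.

Definition block_channel (m : M0 * M1 * M2) (o : {ffun 'I_n -> Y * Z}) : R :=
  \prod_i ch (enc m i) (o i).1 (o i).2.

Definition block_law (o : M0 * M1 * M2 * {ffun 'I_n -> Y * Z}) : R :=
  (#|{: M0 * M1 * M2}|%:R)^-1 * block_channel o.1 o.2.

Let P := block_law.

Lemma block_channel_ge0 m o : 0 <= block_channel m o.
Proof. by case: Hch => ch0 _; exact: prodr_ge0. Qed.

Lemma block_law_ge0 o : 0 <= P o.
Proof. by rewrite mulr_ge0 ?block_channel_ge0// invr_ge0 ler0n. Qed.

Lemma letter_total x : \sum_(t : Y * Z) ch x t.1 t.2 = 1.
Proof. by case: Hch => _ ch1; rewrite sum_pair/= ch1. Qed.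

Lemma block_channel_total m : \sum_o block_channel m o = 1.
Proof.
rewrite /block_channel -(bigA_distr_bigA (fun i (t : Y * Z) => ch (enc m i) t.1 t.2)).
by rewrite big1// => i _; exact: letter_total.
Qed.

Definition update (o : {ffun 'I_n -> Y * Z}) i t : {ffun 'I_n -> Y * Z} :=
  [ffun j => if j == i then t else o j].

(* Exchanging the old and the new letter is a measure-preserving involution. *)
Lemma resample m i (F : {ffun 'I_n -> Y * Z} -> R) :
  \sum_o block_channel m o * F o =
  \sum_o block_channel m o * \sum_(t : Y * Z) ch (enc m i) t.1 t.2 * F (update o i t).
Proof.
pose sigma (ot : {ffun 'I_n -> Y * Z} * (Y * Z)) := (update ot.1 i ot.2, ot.1 i).
have sigmaK : involutive sigma.
  move=> [p t]; rewrite /sigma /update/= ffunE eqxx; congr pair.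
  by apply/ffunP => j; rewrite !ffunE; case: eqP => [->|].
under [RHS]eq_bigr do rewrite mulr_sumr.
rewrite -(sum_pair (fun ot =>
  block_channel m ot.1 * (ch (enc m i) ot.2.1 ot.2.2 * F (update ot.1 i ot.2)))).
rewrite (reindex_inj (inv_inj sigmaK)) sum_pair/=; apply: eq_bigr => o _.
transitivity (\sum_t block_channel m o * F o * ch (enc m i) t.1 t.2).
  by rewrite -mulr_sumr letter_total mulr1.
apply: eq_bigr => t _.
have -> : update (update o i t) i (o i) = o.
  by apply/ffunP => j; rewrite !ffunE; case: eqP => [->|].
rewrite /block_channel (bigD1 i)//= [in RHS](bigD1 i)//= ffunE eqxx.
rewrite (eq_bigr (fun j => ch (enc m j) (update o i t j).1 (update o i t j).2)).
  by ring.
by move=> j /negbTE ji; rewrite ffunE ji.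
Qed.

Definition outY (o : M0 * M1 * M2 * {ffun 'I_n -> Y * Z}) : {ffun 'I_n -> Y} :=
  [ffun i => (o.2 i).1].
Definition outZ (o : M0 * M1 * M2 * {ffun 'I_n -> Y * Z}) : {ffun 'I_n -> Z} :=
  [ffun i => (o.2 i).2].
Definition letter i (o : M0 * M1 * M2 * {ffun 'I_n -> Y * Z}) : X := enc o.1 i.

(** Resampling the [i]-th output leaves [g] unchanged. Given the message, that output is therefore
    independent of [g], with a law that depends on the message only through the input letter. *)
Lemma block_through (T B : finType) (k : X -> T -> R) (psi : Y * Z -> T)
    (g : M0 * M1 * M2 * {ffun 'I_n -> Y * Z} -> B) i :
  (forall x t, \sum_(yz : Y * Z) ch x yz.1 yz.2 * (psi yz == t)%:R = k x t) ->
  (forall m o t, g (m, update o i t) = g (m, o)) ->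
  through_channel P k (fun o => psi (o.2 i)) (letter i) g.
Proof.
move=> kE gi t b; rewrite law_ind sum_pair/= /output.
under [RHS]eq_bigr do rewrite law_ind sum_pair/= mulr_suml.
rewrite [RHS]exchange_big/=; apply: eq_bigr => m _.
under eq_bigr do rewrite /P /block_law/= -mulrA.
rewrite -mulr_sumr (resample m i) mulr_sumr.
under [RHS]eq_bigr do rewrite mulr_suml.
rewrite [RHS]exchange_big/=; apply: eq_bigr => o _.
rewrite (bigD1 (enc m i))//= [X in _ = _ + X]big1 ?addr0; last first.
  by move=> x; rewrite eq_sym => /negbTE xx; rewrite /letter xpair_eqE/= xx mulr0 mul0r.
rewrite /letter xpair_eqE eqxx/= /P /block_law/= -kE -!mulrA; congr (_ * (_ * _)).
rewrite mulr_sumr; apply: eq_bigr => yz _; rewrite gi ffunE eqxx xpair_eqE.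
by case: eqP => _; case: eqP => _ /=; rewrite ?(mulr0, mulr1, mul1r, mul0r).
Qed.

Lemma sum_chanY x y : \sum_(yz : Y * Z) ch x yz.1 yz.2 * (yz.1 == y)%:R = kY x y.
Proof.
rewrite sum_pair/= (bigD1 y)//= [X in _ + X]big1 ?addr0; last first.
  by move=> y' /negbTE yy; rewrite big1// => z _; rewrite yy mulr0.
by apply: eq_bigr => z _; rewrite eqxx mulr1.
Qed.

Lemma sum_chanZ x z : \sum_(yz : Y * Z) ch x yz.1 yz.2 * (yz.2 == z)%:R = kZ x z.
Proof.
rewrite sum_pair exchange_big/= (bigD1 z)//= [X in _ + X]big1 ?addr0; last first.
  by move=> z' /negbTE zz; rewrite big1// => y _; rewrite zz mulr0.
by apply: eq_bigr => y _; rewrite eqxx mulr1.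
Qed.

Lemma context_update i m o t :
  context outY outZ i (m, update o i t) = context outY outZ i (m, o).
Proof.
apply/eqP/context_eqP => j /negbTE ji.
by case: ifP => _; rewrite !ffunE/= ji.
Qed.

Section Context.
Variables (TK : finType) (K : M0 * M1 * M2 -> TK).

Definition context_law i ck (x : X) : R :=
  law P (fun o => (letter i o, (context outY outZ i o, K o.1))) (x, ck).

Lemma context_law_ge0 i ck x : 0 <= context_law i ck x.
Proof. exact/law_ge0/block_law_ge0. Qed.

Lemma cent_outY i :
  cent P (fun o => outY o i) (fun o => (context outY outZ i o, K o.1)) =
  \sum_ck hout kY (context_law i ck).
Proof.
have -> : (fun o => outY o i) = (fun o => (o.2 i).1) by apply/funext => o; rewrite ffunE.
apply: cent_channel; apply: (@block_through _ _ _ fst) => [|m o t]; first exact: sum_chanY.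
by rewrite context_update.
Qed.

Lemma cent_outZ i :
  cent P (fun o => outZ o i) (fun o => (context outY outZ i o, K o.1)) =
  \sum_ck hout kZ (context_law i ck).
Proof.
have -> : (fun o => outZ o i) = (fun o => (o.2 i).2) by apply/funext => o; rewrite ffunE.
apply: cent_channel; apply: (@block_through _ _ _ snd) => [|m o t]; first exact: sum_chanZ.
by rewrite context_update.
Qed.

Lemma sum_context_law i x : \sum_ck context_law i ck x = law P (letter i) x.
Proof. exact: law_pairl. Qed.

End Context.

Hypothesis M_gt0 : (0 < #|{: M0 * M1 * M2}|)%N.

Lemma block_law_total : \sum_o P o = 1.
Proof.
rewrite sum_pair/=; under eq_bigr do rewrite -mulr_sumr block_channel_total mulr1.
by rewrite sumr_const -[LHS]mulr_natl divff// pnatr_eq0 -lt0n.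
Qed.

(** Fibres of equal size [c] make the image of the uniform message uniform. *)
Lemma entropy_message (T : finType) (f : M0 * M1 * M2 -> T) c :
  (0 < c)%N -> (#|T| * c = #|{: M0 * M1 * M2}|)%N ->
  (forall t, \sum_m (f m == t)%:R = c%:R :> R) ->
  entropy P (fun o => f o.1) = log2 #|T|%:R.
Proof.
move=> c0 Tc fc; apply: entropy_uniform => [|t].
  by move: M_gt0; rewrite -Tc muln_gt0 => /andP[].
rewrite law_ind sum_pair/=.
under eq_bigr do rewrite -mulr_suml /P /block_law/= -mulr_sumr block_channel_total mulr1.
rewrite -mulr_sumr -Tc natrM.
by rewrite fc invfM -mulrA mulVf ?mulr1// pnatr_eq0 -lt0n.
Qed.

Let K0 (m : M0 * M1 * M2) := m.1.1.
Let K01 (m : M0 * M1 * M2) := (m.1.1, m.1.2).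
Let K02 (m : M0 * M1 * M2) := (m.1.1, m.2).
Let t0 : R := log2 #|M0|%:R.
Let t1 : R := log2 #|M1|%:R.
Let t2 : R := log2 #|M2|%:R.

Lemma messages_gt0 : [/\ (0 < #|M0|)%N, (0 < #|M1|)%N & (0 < #|M2|)%N].
Proof. by move: M_gt0; rewrite !card_prod !muln_gt0 => /andP[/andP[]]. Qed.

Lemma entropy_M0 : entropy P (fun o => K0 o.1) = t0.
Proof.
have [m0 m1 m2] := messages_gt0.
apply: (@entropy_message _ K0 (#|M1| * #|M2|)).
- by rewrite muln_gt0 m1.
- by rewrite !card_prod mulnA.
move=> t; rewrite !sum_pair (bigD1 t)//= [X in _ + X]big1 ?addr0; last first.
  by move=> m /negbTE mt; rewrite big1// => ? _; rewrite big1// => ? _; rewrite /K0/= mt.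
by under eq_bigr do rewrite /K0/= eqxx sumr_const; rewrite sumr_const natrM mulr_natl.
Qed.

Lemma entropy_M01 : entropy P (fun o => K01 o.1) = t0 + t1.
Proof.
have [m0 m1 m2] := messages_gt0.
rewrite /t0 /t1 -log2M ?ltr0n// -natrM -card_prod.
apply: (@entropy_message _ K01 #|M2|) => //.
  by rewrite !card_prod.
move=> [t s]; rewrite !sum_pair (bigD1 t)//= [X in _ + X]big1 ?addr0; last first.
  move=> m /negbTE mt; rewrite big1// => ? _; rewrite big1// => ? _.
  by rewrite /K01/= xpair_eqE mt.
rewrite (bigD1 s)//= [X in _ + X]big1 ?addr0; last first.
  by move=> m /negbTE mt; rewrite big1// => ? _; rewrite /K01/= xpair_eqE mt andbF.
by under eq_bigr do rewrite /K01/= eqxx; rewrite sumr_const.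
Qed.

Lemma entropy_M02 : entropy P (fun o => K02 o.1) = t0 + t2.
Proof.
have [m0 m1 m2] := messages_gt0.
rewrite /t0 /t2 -log2M ?ltr0n// -natrM -card_prod.
apply: (@entropy_message _ K02 #|M1|) => //.
  by rewrite !card_prod mulnAC.
move=> [t s]; rewrite !sum_pair (bigD1 t)//= [X in _ + X]big1 ?addr0; last first.
  move=> m /negbTE mt; rewrite big1// => ? _; rewrite big1// => ? _.
  by rewrite /K02/= xpair_eqE mt.
rewrite exchange_big/= (bigD1 s)//= [X in _ + X]big1 ?addr0; last first.
  by move=> m /negbTE mt; rewrite big1// => ? _; rewrite /K02/= xpair_eqE mt andbF.
by under eq_bigr do rewrite /K02/= eqxx; rewrite sumr_const.
Qed.

Lemma entropy_M : entropy P (fun o => o.1) = t0 + t1 + t2.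
Proof.
have [m0 m1 m2] := messages_gt0.
rewrite /t0 /t1 /t2 -!log2M ?ltr0n ?mulr_gt0 ?ltr0n// -!natrM -!card_prod.
apply: (@entropy_message _ id 1) => //; first by rewrite muln1.
by move=> t; rewrite (bigD1 t)//= eqxx big1 ?addr0// => m /negbTE ->.
Qed.

Variables (decY : {ffun 'I_n -> Y} -> M0 * M1) (decZ : {ffun 'I_n -> Z} -> M0 * M2).

Definition failure (o : M0 * M1 * M2 * {ffun 'I_n -> Y * Z}) : bool :=
  [|| (decY (outY o)).1 != o.1.1.1, (decZ (outZ o)).1 != o.1.1.1,
      (decY (outY o)).2 != o.1.1.2 | (decZ (outZ o)).2 != o.1.2].

Definition failure_prob : R := \sum_(o | failure o) P o.

Let pe := failure_prob.

Lemma log2_card_ge0 (A : finType) : (0 < #|A|)%N -> 0 <= log2 #|A|%:R :> R.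
Proof.
move=> A0; rewrite /log2 divr_ge0// ?ln_ge0 ?ler1n//.
Qed.

Lemma fano_failure (A B : finType) (f : _ -> A) (g : _ -> B) (dec : B -> A) :
  (0 < #|A|)%N -> (forall o, dec (g o) != f o -> failure o) ->
  cent P f g <= 1 + pe * log2 #|A|%:R.
Proof.
move=> A0 df; apply: le_trans (fano block_law_ge0 block_law_total f g dec) _.
rewrite lerD2l ler_wpM2r ?log2_card_ge0//.
rewrite /pe /failure_prob big_mkcond [leRHS]big_mkcond; apply: ler_sum => o _.
case: ifP => [/df -> //|_]; case: ifP => // _; exact: block_law_ge0.
Qed.

Lemma fano_M0_Y : cent P (fun o => K0 o.1) outY <= 1 + pe * t0.
Proof.
have [m0 m1 m2] := messages_gt0.
by apply: (@fano_failure _ _ _ _ (fst \o decY)) => // o; rewrite /failure => ->.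
Qed.

Lemma fano_M0_Z : cent P (fun o => K0 o.1) outZ <= 1 + pe * t0.
Proof.
have [m0 m1 m2] := messages_gt0.
by apply: (@fano_failure _ _ _ _ (fst \o decZ)) => // o; rewrite /failure => ->; rewrite orbT.
Qed.

Lemma fano_M01 : cent P (fun o => K01 o.1) outY <= 1 + pe * (t0 + t1).
Proof.
have [m0 m1 m2] := messages_gt0.
rewrite /t0 /t1 -log2M ?ltr0n// -natrM -card_prod.
apply: (@fano_failure _ _ _ _ decY) => [|o]; first by rewrite card_prod muln_gt0 m0.
rewrite -pair_eqE /pair_eq/= /failure negb_and.
by case/orP => ->; rewrite ?orbT.
Qed.

Lemma fano_M02 : cent P (fun o => K02 o.1) outZ <= 1 + pe * (t0 + t2).
Proof.
have [m0 m1 m2] := messages_gt0.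
rewrite /t0 /t2 -log2M ?ltr0n// -natrM -card_prod.
apply: (@fano_failure _ _ _ _ decZ) => [|o]; first by rewrite card_prod muln_gt0 m0.
rewrite -pair_eqE /pair_eq/= /failure negb_and.
by case/orP => ->; rewrite ?orbT.
Qed.

Lemma fano_M1 (B : finType) (g : _ -> B) :
  cent P (fun o => o.1.1.2) (fun o => (outY o, g o)) <= 1 + pe * t1.
Proof.
have [m0 m1 m2] := messages_gt0.
apply: (@fano_failure _ _ _ _ (fun yg => (decY yg.1).2)) => // o.
by rewrite /failure => ->; rewrite !orbT.
Qed.

Lemma fano_M2 (B : finType) (g : _ -> B) :
  cent P (fun o => o.1.2) (fun o => (outZ o, g o)) <= 1 + pe * t2.
Proof.
have [m0 m1 m2] := messages_gt0.
apply: (@fano_failure _ _ _ _ (fun yg => (decZ yg.1).2)) => // o.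
by rewrite /failure => ->; rewrite !orbT.
Qed.

(** H(M) = I(M0,M1;Y^n) + H(M0,M1|Y^n) + I(M2;Z^n|M0,M1) + H(M2|Z^n,M0,M1). Fano's inequality bounds
    the second and the fourth term. *)
Lemma sum_rate_Y : entropy P (fun o => o.1) =
  entropy P outY - cent P outY (fun o => K01 o.1) + cent P (fun o => K01 o.1) outY +
  (cent P outZ (fun o => K01 o.1) - cent P outZ (fun o => o.1)) +
  cent P (fun o => o.1.2) (fun o => (outZ o, K01 o.1)).
Proof.
have e1 : entropy P (fun o => (o.1.2, (outZ o, K01 o.1))) = entropy P (fun o => (outZ o, o.1)).
  apply: entropy_ker => -[[[u v] w] z] [[[u' v'] w'] z'].
  by rewrite /K01/= !xpair_eqE/= andbCA; congr (_ && _); rewrite andbC.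
have := cent_swap P (fun o => K01 o.1) outY; rewrite /cent e1; lra.
Qed.

Lemma sum_rate_Z : entropy P (fun o => o.1) =
  entropy P outZ - cent P outZ (fun o => K02 o.1) + cent P (fun o => K02 o.1) outZ +
  (cent P outY (fun o => K02 o.1) - cent P outY (fun o => o.1)) +
  cent P (fun o => o.1.1.2) (fun o => (outY o, K02 o.1)).
Proof.
have e1 : entropy P (fun o => (o.1.1.2, (outY o, K02 o.1))) = entropy P (fun o => (outY o, o.1)).
  apply: entropy_ker => -[[[u v] w] z] [[[u' v'] w'] z'].
  by rewrite /K02/= !xpair_eqE/= andbCA; congr (_ && _); rewrite andbCA andbA.
have := cent_swap P (fun o => K02 o.1) outZ; rewrite /cent e1; lra.
Qed.

Hypothesis n_gt0 : (0 < n)%N.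
Let ninv : R := n%:R^-1.

(* W consists of a uniform time index i, the context Y^{i-1}, Z_{i+1}^n and the common
   message; U and V are the private messages. *)
Definition aux_a (w : 'I_n * ({ffun 'I_n -> option (Y + Z)} * M0)) (m1 : M1) (x : X) : R :=
  ninv * context_law K01 w.1 (w.2.1, (w.2.2, m1)) x.

Definition aux_b (w : 'I_n * ({ffun 'I_n -> option (Y + Z)} * M0)) (m2 : M2) (x : X) : R :=
  ninv * context_law K02 w.1 (w.2.1, (w.2.2, m2)) x.

Let ninv_ge0 : 0 <= ninv. Proof. by rewrite invr_ge0 ler0n. Qed.

Lemma marg_context (A B : finType) (f : M0 * M1 * M2 -> A) (g : M0 * M1 * M2 -> B) i c t x :
  \sum_s context_law (fun m => (f m, g m)) i (c, (t, s)) x = context_law f i (c, t) x.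
Proof.
rewrite /context_law /law [RHS](partition_big (fun o => g o.1) xpredT)//=.
apply: eq_bigr => s _; apply: eq_bigl => o; rewrite !xpair_eqE.
by rewrite !andbA.
Qed.

Lemma marg_aux_a w : marg aux_a w = fun x => ninv * context_law K0 w.1 w.2 x.
Proof.
apply/funext => x; rewrite /marg -mulr_sumr; congr (_ * _).
by case: w => i [c m0] /=; exact: (marg_context (fun m => m.1.1) (fun m => m.1.2)).
Qed.

Lemma marg_aux_b w : marg aux_b w = fun x => ninv * context_law K0 w.1 w.2 x.
Proof.
apply/funext => x; rewrite /marg -mulr_sumr; congr (_ * _).
by case: w => i [c m0] /=; exact: (marg_context (fun m => m.1.1) (fun m => m.2)).
Qed.

Lemma input_aux x : input aux_a x = ninv * \sum_i law P (letter i) x.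
Proof.
rewrite /input; under eq_bigr do rewrite marg_aux_a.
rewrite -mulr_sumr sum_pair; congr (_ * _); apply: eq_bigr => i _.
exact: sum_context_law.
Qed.

Lemma aux_dataP : aux_data aux_a aux_b.
Proof.
split.
- by move=> w u x; rewrite mulr_ge0 ?context_law_ge0.
- by move=> w u x; rewrite mulr_ge0 ?context_law_ge0.
- by move=> w x; rewrite marg_aux_a marg_aux_b.
- under eq_bigr do rewrite input_aux.
  rewrite -mulr_sumr exchange_big/=.
  under eq_bigr do rewrite law_total block_law_total.
  by rewrite sumr_const card_ord mulVf// pnatr_eq0 -lt0n.
Qed.

Section Sums.
Variables (T : finType) (k : X -> T -> R).
Hypothesis k0 : forall x t, 0 <= k x t.

Lemma sum_hout_marg : \sum_w hout k (marg aux_a w) =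
  ninv * \sum_i \sum_ck hout k (context_law K0 i ck).
Proof.
rewrite sum_pair mulr_sumr; apply: eq_bigr => i _; rewrite mulr_sumr; apply: eq_bigr => ck _.
by rewrite marg_aux_a houtZ// => x; exact: context_law_ge0.
Qed.

Lemma sum_hout_a : \sum_w \sum_u hout k (aux_a w u) =
  ninv * \sum_i \sum_ck hout k (context_law K01 i ck).
Proof.
rewrite sum_pair mulr_sumr; apply: eq_bigr => i _.
rewrite mulr_sumr !sum_pair/=; apply: eq_bigr => c _.
rewrite sum_pair; apply: eq_bigr => m0 _; apply: eq_bigr => m1 _.
by rewrite /aux_a houtZ// => x; exact: context_law_ge0.
Qed.

Lemma sum_hout_b : \sum_w \sum_u hout k (aux_b w u) =
  ninv * \sum_i \sum_ck hout k (context_law K02 i ck).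
Proof.
rewrite sum_pair mulr_sumr; apply: eq_bigr => i _.
rewrite mulr_sumr !sum_pair/=; apply: eq_bigr => c _.
rewrite sum_pair; apply: eq_bigr => m0 _; apply: eq_bigr => m1 _.
by rewrite /aux_b houtZ// => x; exact: context_law_ge0.
Qed.

(** Concavity of the output entropy, obtained from superadditivity and homogeneity; it lets the time
    index become part of W. *)
Lemma hout_input_ge : ninv * \sum_i hout k (law P (letter i)) <= hout k (input aux_a).
Proof.
have -> : input aux_a = fun x => ninv * \sum_i law P (letter i) x.
  by apply/funext => x; exact: input_aux.
have l0 i x : 0 <= law P (letter i) x by exact/law_ge0/block_law_ge0.
rewrite houtZ//; last by move=> x; exact: sumr_ge0.
by rewrite ler_wpM2l// hout_superadditive.
Qed.

(** [noise] is linear, so it can be compared slice by slice. The right-hand side enters the sum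
    rates with a minus sign; replacing it by [noise] therefore only weakens them. *)
Lemma noise_input_le : noise k (input aux_a) <=
  ninv * \sum_i \sum_ck hout k (context_law id i ck).
Proof.
have -> : noise k (input aux_a) = ninv * \sum_i \sum_ck noise k (context_law id i ck).
  rewrite /noise; under eq_bigr do rewrite input_aux -mulrA mulr_suml.
  rewrite -mulr_sumr exchange_big/=; congr (_ * _); apply: eq_bigr => i _.
  rewrite exchange_big/=; apply: eq_bigr => x _; rewrite -mulr_suml.
  by rewrite (sum_context_law id).
rewrite ler_wpM2l//; apply: ler_sum => i _; apply: ler_sum => ck _.
by apply: noise_le_hout => // x; exact: context_law_ge0.
Qed.

End Sums.

Let sY (TK : finType) (K : M0 * M1 * M2 -> TK) : R :=
  \sum_i \sum_ck hout kY (context_law K i ck).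
Let sZ (TK : finType) (K : M0 * M1 * M2 -> TK) : R :=
  \sum_i \sum_ck hout kZ (context_law K i ck).

Lemma sum_cent_outY (TK : finType) (K : M0 * M1 * M2 -> TK) :
  \sum_(i < n) cent P (fun o => outY o i) (fun o => (context outY outZ i o, K o.1)) = sY K.
Proof. by apply: eq_bigr => i _; rewrite cent_outY. Qed.

Lemma sum_cent_outZ (TK : finType) (K : M0 * M1 * M2 -> TK) :
  \sum_(i < n) cent P (fun o => outZ o i) (fun o => (context outY outZ i o, K o.1)) = sZ K.
Proof. by apply: eq_bigr => i _; rewrite cent_outZ. Qed.

Lemma sY_le (TK : finType) (K : M0 * M1 * M2 -> TK) : sY K <= cent P outY (fun o => K o.1).
Proof. by rewrite -sum_cent_outY; exact: (cent_block_ge block_law_ge0). Qed.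

Lemma sZ_le (TK : finType) (K : M0 * M1 * M2 -> TK) : sZ K <= cent P outZ (fun o => K o.1).
Proof. by rewrite -sum_cent_outZ; exact: (cent_block_ge_future block_law_ge0). Qed.

Lemma sYZ (TK : finType) (K : M0 * M1 * M2 -> TK) :
  sY K - sZ K = cent P outY (fun o => K o.1) - cent P outZ (fun o => K o.1).
Proof.
by rewrite -(csiszar_sum P outY outZ (fun o => K o.1)) sumrB sum_cent_outY sum_cent_outZ.
Qed.

Let nn : n%:R * ninv = 1. Proof. by rewrite mulfV// pnatr_eq0 -lt0n. Qed.

Lemma entropy_outY_le : entropy P outY <= n%:R * hout kY (input aux_a).
Proof.
apply: le_trans (entropy_block_le block_law_ge0 block_law_total outY) _.
rewrite -[leLHS]mul1r -[X in X * _ <= _]nn -mulrA ler_wpM2l ?ler0n//.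
apply: le_trans (hout_input_ge chanY_ge0); rewrite ler_wpM2l//.
apply: ler_sum => i _; rewrite le_eqVlt; apply/orP; left; apply/eqP.
have -> : (fun o => outY o i) = (fun o => (o.2 i).1) by apply/funext => o; rewrite ffunE.
apply: (@entropy_channel _ _ _ block_law_total _ _ _ _ _ _ (fun=> tt)).
by apply: (@block_through _ _ _ fst) => //; exact: sum_chanY.
Qed.

Lemma entropy_outZ_le : entropy P outZ <= n%:R * hout kZ (input aux_a).
Proof.
apply: le_trans (entropy_block_le block_law_ge0 block_law_total outZ) _.
rewrite -[leLHS]mul1r -[X in X * _ <= _]nn -mulrA ler_wpM2l ?ler0n//.
apply: le_trans (hout_input_ge chanZ_ge0); rewrite ler_wpM2l//.
apply: ler_sum => i _; rewrite le_eqVlt; apply/orP; left; apply/eqP.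
have -> : (fun o => outZ o i) = (fun o => (o.2 i).2) by apply/funext => o; rewrite ffunE.
apply: (@entropy_channel _ _ _ block_law_total _ _ _ _ _ _ (fun=> tt)).
by apply: (@block_through _ _ _ snd) => //; exact: sum_chanZ.
Qed.

Lemma failure_prob_ge0 : 0 <= pe.
Proof. by apply: sumr_ge0 => o _; exact: block_law_ge0. Qed.

(** A code may have more messages than its rate demands, so [pe * T] need not be small relative to
    [n]. But [T] enters with coefficient [1 - pe >= 0] and can first be lowered to [n%:R * r]. The 2
    allows for two uses of Fano's inequality, and [rt] gives all six bounds the same slack. *)
Lemma rate_slack T r rt B : n%:R * r <= T -> pe <= 1 -> r <= rt ->
  T - (2 + pe * T) <= n%:R * B -> r <= B + (pe * rt + 2 / n%:R).
Proof.
move=> rT pe1 rrt TB; have pe0 := failure_prob_ge0.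
have N0 : 0 < n%:R :> R by rewrite ltr0n.
rewrite -(ler_pM2l N0); apply: le_trans (_ : n%:R * B + (2 + pe * (n%:R * r)) <= _).
  rewrite -lerBlDr; apply: le_trans TB.
  suff : 0 <= (1 - pe) * (T - n%:R * r) by lra.
  by rewrite mulr_ge0 ?subr_ge0.
rewrite !mulrDr lerD2l addrC [n%:R * (2 / _)]mulrCA mulfV ?gt_eqF// mulr1 lerD2r.
by rewrite mulrCA ler_wpM2l// ?ler_wpM2l// ltW.
Qed.

Lemma converse r0 r1 r2 : 0 <= r0 -> 0 <= r1 -> 0 <= r2 -> pe <= 1 ->
  n%:R * r0 <= t0 -> n%:R * r1 <= t1 -> n%:R * r2 <= t2 ->
  attained kY kZ ('I_n * ({ffun 'I_n -> option (Y + Z)} * M0))%type M1 M2 r0 r1 r2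
    (pe * (r0 + r1 + r2) + 2 / n%:R).
Proof.
move=> r0p r1p r2p pe1 T0 T1 T2.
exists aux_a, aux_b; split; first exact: aux_dataP.
have HY := entropy_outY_le; have HZ := entropy_outZ_le.
have R0Y := cent_swap P (fun o => K0 o.1) outY.
have R0Z := cent_swap P (fun o => K0 o.1) outZ.
have R01 := cent_swap P (fun o => K01 o.1) outY.
have R02 := cent_swap P (fun o => K02 o.1) outZ.
rewrite entropy_M0 in R0Y R0Z; rewrite entropy_M01 in R01; rewrite entropy_M02 in R02.
have SY := sum_rate_Y; have SZ := sum_rate_Z; rewrite entropy_M in SY SZ.
have F0Y := fano_M0_Y; have F0Z := fano_M0_Z; have F01 := fano_M01; have F02 := fano_M02.
have F1 := fano_M1 (fun o => K02 o.1); have F2 := fano_M2 (fun o => K01 o.1).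
have Y0 := sY_le K0; have Z0 := sZ_le K0; have Y01 := sY_le K01; have Z02 := sZ_le K02.
have YM := sY_le id; have ZM := sZ_le id.
have YZ01 := sYZ K01; have YZ02 := sYZ K02.
have nY := noise_input_le chanY_ge0; have nZ := noise_input_le chanZ_ge0.
rewrite -(ler_pM2l (_ : 0 < n%:R :> R)) ?ltr0n// mulrA nn mul1r in nY.
rewrite -(ler_pM2l (_ : 0 < n%:R :> R)) ?ltr0n// mulrA nn mul1r in nZ.
rewrite -/(sY id) in nY; rewrite -/(sZ id) in nZ.
rewrite /outer_bound !(sum_hout_marg chanY_ge0) !(sum_hout_marg chanZ_ge0).
rewrite !(sum_hout_a chanY_ge0) !(sum_hout_a chanZ_ge0) !(sum_hout_b chanY_ge0) !(sum_hout_b chanZ_ge0).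
rewrite -!/(sY _) -!/(sZ _).
have E (x y : R) : n%:R * (x - ninv * y) = n%:R * x - y by rewrite mulrBr mulrA nn mul1r.
have E4 (x y z v : R) : n%:R * (x - ninv * y + ninv * z - v) = n%:R * x - y + z - n%:R * v.
  by rewrite mulrBr mulrDr E mulrA nn mul1r.
split; [| |split].
- apply: (rate_slack T0) => //; first lra.
  rewrite E; lra.
- apply: (rate_slack T0) => //; first lra.
  rewrite E; lra.
- apply: (@rate_slack (t0 + t1)) => //; [lra|lra|rewrite E; lra].
- apply: (@rate_slack (t0 + t2)) => //; [lra|lra|rewrite E; lra].
(* H(Z^n|M0,M1) occurs with a plus sign, where [sZ_le] points the wrong way. The identity [YZ01]
   turns its difference with H(Y^n|M0,M1) exactly into single-letter sums; [YZ02] does the same for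
   the other sum rate. *)
- apply: (@rate_slack (t0 + t1 + t2)) => //; [lra|rewrite E4; lra].
- apply: (@rate_slack (t0 + t1 + t2)) => //; [lra|rewrite E4; lra].
Qed.

End Code.

(** * From codes to the capacity region *)

Section Converse.
Variables (R : realType) (X Y Z : finType) (ch : X -> Y -> Z -> R).
Hypothesis Hch : is_bc_channel ch.

Let kY := chanY ch.
Let kZ := chanZ ch.

Section CodeAsBlockLaw.
Variables (n : nat) (c : bc_code X Y Z n).

Definition code_enc (m : 'I_(size0 c) * 'I_(size1 c) * 'I_(size2 c)) (i : 'I_n) : X :=
  tnth (@encoder _ _ _ _ c m.1.1 m.1.2 m.2) i.

Definition code_decY (y : {ffun 'I_n -> Y}) := @decoder1 _ _ _ _ c [tuple y i | i < n].
Definition code_decZ (z : {ffun 'I_n -> Z}) := @decoder2 _ _ _ _ c [tuple z i | i < n].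

Lemma error_probE : error_prob ch c = failure_prob ch code_enc code_decY code_decZ.
Proof.
rewrite /error_prob /failure_prob [RHS]big_mkcond/= 3!sum_pair/=.
rewrite mulr_sumr; apply: eq_bigr => m0 _; rewrite mulr_sumr; apply: eq_bigr => m1 _.
rewrite mulr_sumr; apply: eq_bigr => m2 _.
pose join (yz : n.-tuple Y * n.-tuple Z) : {ffun 'I_n -> Y * Z} :=
  [ffun i => (tnth yz.1 i, tnth yz.2 i)].
pose split (o : {ffun 'I_n -> Y * Z}) : n.-tuple Y * n.-tuple Z :=
  ([tuple (o i).1 | i < n], [tuple (o i).2 | i < n]).
rewrite [RHS](reindex join); last first.
  exists split => [[y z] _|o _].
    by congr pair; apply: eq_from_tnth => i; rewrite tnth_mktuple ffunE.
  by apply/ffunP => i; rewrite ffunE !tnth_mktuple; case: (o i).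
rewrite sum_pair mulr_sumr; apply: eq_bigr => y _; rewrite mulr_sumr; apply: eq_bigr => z _.
rewrite /failure /block_law /block_channel /code_decY /code_decZ /channel_n/= !card_prod !card_ord.
have -> : [tuple (outY (m0, m1, m2, join (y, z))) i | i < n] = y.
  by apply: eq_from_tnth => i; rewrite tnth_mktuple !ffunE.
have -> : [tuple (outZ (m0, m1, m2, join (y, z))) i | i < n] = z.
  by apply: eq_from_tnth => i; rewrite tnth_mktuple !ffunE.
case: ifP => _; rewrite ?mulr0// mulr1; congr (_ * _).
by apply: eq_bigr => i _; rewrite ffunE.
Qed.

End CodeAsBlockLaw.

Lemma rate_le_log2 (r : R) (n s : nat) : 2 `^ (n%:R * r) <= s%:R ->
  (0 < s)%N /\ n%:R * r <= log2 s%:R.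
Proof.
move=> le; have p0 : 0 < (2 : R) `^ (n%:R * r) by rewrite powR_gt0.
have s0 : 0 < s%:R :> R := lt_le_trans p0 le.
split; first by rewrite -(ltr0n R).
by rewrite /log2 ler_pdivlMr ?ln2_gt0// -ln_powR ler_ln ?posrE.
Qed.

Lemma attained_weaken (W U V : finType) r0 r1 r2 s0 s1 s2 d e e' :
  s0 <= r0 + d -> s1 <= r1 + d -> s2 <= r2 + d -> 0 <= d -> e + 3 * d <= e' ->
  attained kY kZ W U V r0 r1 r2 e -> attained kY kZ W U V s0 s1 s2 e'.
Proof.
move=> h0 h1 h2 d0 de [a [b [ab [B1 B2 [B3 B4 B5 B6]]]]]; exists a, b; split=> //.
split; [lra|lra|split; lra].
Qed.

Lemma achievable_attained d r0 r1 r2 e : (#|X| + 6 <= d)%N -> 0 < e ->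
  achievable ch r0 r1 r2 -> attained kY kZ 'I_d 'I_d 'I_d r0 r1 r2 e.
Proof.
move=> Xd e0 [r0p [r1p [r2p [c [sizes /cvgr0Pnorm_lt err]]]]].
have rt0 : 0 <= r0 + r1 + r2 by rewrite !addr_ge0.
(* The error must be at most 1 for [rate_slack], and its product with the total rate at most
   [e / 2]; adding 1 keeps the denominator positive. *)
pose eta := Num.min 1 (e / 2 / (1 + (r0 + r1 + r2))).
have eta0 : 0 < eta by rewrite lt_min ltr01/= !divr_gt0// ltr_pwDl.
have [N _ HN] := err _ eta0.
(* Beyond [4 / e] the term [2 / n] is at most [e / 2]; the successor makes [n] positive. *)
pose n := maxn N (Num.bound (4 / e)).+1.
have n0 : (0 < n)%N by rewrite leq_max orbT.
have ne : 4 / e <= n%:R.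
  apply: le_trans (ltW (archi_boundP _)) _; first by rewrite divr_ge0// ltW.
  by rewrite ler_nat leq_max leqnSn orbT.
have pe_lt : failure_prob ch (@code_enc _ (c n)) (@code_decY _ (c n)) (@code_decZ _ (c n)) < eta.
  by rewrite -error_probE; apply: le_lt_trans (ler_norm _) _; apply: HN; rewrite /= leq_max leqnn.
move: pe_lt; set pe := failure_prob _ _ _ _; rewrite lt_min => /andP[pe1 pee].
have [/rate_le_log2[s0 T0] [/rate_le_log2[s1 T1] /rate_le_log2[s2 T2]]] := sizes n.
have M_gt0 : (0 < #|{: 'I_(size0 (c n)) * 'I_(size1 (c n)) * 'I_(size2 (c n))}|)%N.
  by rewrite !card_prod !card_ord !muln_gt0 s0 s1 s2.
have := @converse _ _ _ _ _ Hch _ _ _ _ (@code_enc _ (c n)) M_gt0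
  (@code_decY _ (c n)) (@code_decZ _ (c n)) n0 r0 r1 r2 r0p r1p r2p (ltW pe1).
rewrite !card_ord => /(_ T0 T1 T2) att.
have kY0 := chanY_ge0 Hch; have kZ0 := chanZ_ge0 Hch.
have Xd2 : (#|X| + 2 <= d)%N by apply: leq_trans Xd; rewrite leq_add2l.
have att2 := attained_reduce kY0 kZ0 Xd (attained_reduce_conditional kY0 kZ0 Xd2 att).
apply: (attained_weaken _ _ _ (lexx 0) _ att2); rewrite ?addr0// mulr0 addr0 -/pe.
have pt : pe * (r0 + r1 + r2) <= e / 2.
  move: pee; rewrite ltr_pdivlMr ?ltr_pwDl// mulrDr mulr1 => h.
  apply: le_trans (ltW h); rewrite lerDr; exact: failure_prob_ge0.
have : 2 / n%:R <= e / 2.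
  rewrite ler_pdivrMr ?ltr0n//; move: ne; rewrite ler_pdivrMr//; lra.
lra.
Qed.

Lemma capacity_region_attained d r0 r1 r2 : (#|X| + 6 <= d)%N ->
  in_capacity_region ch r0 r1 r2 -> attained kY kZ 'I_d 'I_d 'I_d r0 r1 r2 0.
Proof.
move=> Xd cap; apply: attained_limit => e e0.
(* Moving three rates by [e / 6] costs at most [e / 2] in a sum rate; the other half is the slack of
   the code. A single limit thus handles both the closure and the slack. *)
have [s0 [s1 [s2 [ach [h0 [h1 h2]]]]]] := cap (e / 6) ltac:(lra).
have e2 : 0 < e / 2 by lra.
apply: (@attained_weaken _ _ _ s0 s1 s2 _ _ _ (e / 6) (e / 2)) (achievable_attained Xd e2 ach).
- by move: h0; rewrite ltr_norml => /andP[]; lra.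
- by move: h1; rewrite ltr_norml => /andP[]; lra.
- by move: h2; rewrite ltr_norml => /andP[]; lra.
- lra.
- lra.
Qed.

End Converse.

Theorem theorem2p1 (R : realType) (X Y Z : finType) (ch : X -> Y -> Z -> R)
  (Hch : is_bc_channel ch) (R0 R1 R2 : R) :
  in_capacity_region ch R0 R1 R2 ->
  exists (U V W : finType) (pU : U -> R) (pV : V -> R)
         (pW : U -> V -> W -> R) (pX : U -> V -> W -> X -> R),
    is_pmf pU /\ is_pmf pV /\
    (forall u v, is_pmf (pW u v)) /\ (forall u v w, is_pmf (pX u v w)) /\
    let P := fun o : U * V * W * X * Y * Z =>
      let: (u, v, w, x, y, z) := o in
      pU u * pV v * pW u v w * pX u v w x * ch x y z in
    let rU := fun o : U * V * W * X * Y * Z => o.1.1.1.1.1 in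
    let rV := fun o : U * V * W * X * Y * Z => o.1.1.1.1.2 in
    let rW := fun o : U * V * W * X * Y * Z => o.1.1.1.2 in
    let rY := fun o : U * V * W * X * Y * Z => o.1.2 in
    let rZ := fun o : U * V * W * X * Y * Z => o.2 in
    let rUW := fun o => (rU o, rW o) in
    let rVW := fun o => (rV o, rW o) in
    R0 <= Num.min (mutinfo P rW rY) (mutinfo P rW rZ) /\
    R0 + R1 <= mutinfo P rUW rY /\
    R0 + R2 <= mutinfo P rVW rZ /\
    R0 + R1 + R2 <= mutinfo P rUW rY + cmutinfo P rV rZ rUW /\
    R0 + R1 + R2 <= mutinfo P rVW rZ + cmutinfo P rU rY rVW.
Proof.
move=> cap.
(* The alphabet size is the successor of [#|X| + 6], so that U and V range over cyclic groups as
   [padding] requires. *)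
have [a [b [[a0 b0 ab a1] B]]] := capacity_region_attained Hch (leqnSn _) cap.
exact: (padding Hch a0 b0 ab a1 B).
Qed.
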